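(* Let $d\in\mathbb{N}$, let $\alpha>1/2$ be a real number and let $\boldsymbol{\gamma}=(\gamma_1,\gamma_2,\ldots)$ be a sequence of real numbers with $0\le \gamma_j\le 1$ for all $j$. Let $r,M\in\mathbb{N}$ with $M\ge 2$. Assume that $M$ and $\eta\in(0,1)$ satisfy $$(1-\eta)M \;\ge\; \inf_{1/2\le \lambda<\alpha}\, 2\prod_{j=1}^{d}\left(1+2\gamma_j^{1/\lambda}\zeta(\alpha/\lambda)\right).$$ Then for any $1/2<\lambda<\alpha$ and $0<\delta<\min(\lambda-1/2,1)$, $$e^{\mathrm{ran}}(H_{\alpha,\boldsymbol{\gamma}};A^{\mathrm{ran}}_{r,M})\le \frac{r\,C_{\lambda,\delta}}{(1-\eta)^{\lambda-\delta-1/2}M^{\lambda-\delta+1/2}}\prod_{j=1}^{d}\left(1+2\gamma_j^{1/\lambda}\zeta(\alpha/\lambda)\right)^{\lambda-\delta}+(1-\eta)^r\prod_{j=1}^{d}\left(1+2\gamma_j^{2}\zeta(2\alpha)\right)^{1/2},$$ where $C_{\lambda,\delta}$ is a positive constant depending only on $\lambda$ and $\delta$.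
   Context: $\zeta$ is the Riemann zeta function. Weighted Korobov space. For $\boldsymbol{k}\in\mathbb{Z}^d$ let $r_{\alpha,\boldsymbol{\gamma}}(\boldsymbol{k})=\prod_{j:\,k_j\neq 0}|k_j|^{\alpha}/\gamma_j$ (empty product $=1$; $|k_j|^\alpha/\gamma_j=\infty$ if $\gamma_j=0$; $1/\infty=0$, $\infty\cdot 0=0$). For $\alpha>1/2$, $H_{\alpha,\boldsymbol{\gamma}}$ is the space of functions $f:[0,1]^d\to\mathbb{R}$, one-periodic in each variable, with absolutely convergent Fourier series $f(\boldsymbol{x})=\sum_{\boldsymbol{k}\in\mathbb{Z}^d}\hat f(\boldsymbol{k})e^{2\pi i\boldsymbol{k}\cdot\boldsymbol{x}}$, where $\hat f(\boldsymbol{k})=\int_{[0,1]^d}f(\boldsymbol{x})e^{-2\pi i\boldsymbol{k}\cdot\boldsymbol{x}}\,d\boldsymbol{x}$, such that $\hat f(\boldsymbol{k})=0$ whenever $r_{\alpha,\boldsymbol{\gamma}}(\boldsymbol{k})=\infty$ and $\|f\|_{\alpha,\boldsymbol{\gamma}}^2=\sum_{\boldsymbol{k}}|\hat f(\boldsymbol{k})|^2 r_{\alpha,\boldsymbol{\gamma}}(\boldsymbol{k})^2<\infty$. Lattice rules. $I(f)=\int_{[0,1]^d}f(\boldsymbol{x})\,d\boldsymbol{x}$. For $N\ge 2$ and $\boldsymbol{z}\in\{1,\ldots,N-1\}^d$, the rank-1 lattice point set is $P_{N,\boldsymbol{z}}=\{(\{nz_1/N\},\ldots,\{nz_d/N\}):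 0\le n<N\}$, with $\{x\}=x-\lfloor x\rfloor$. For an $N$-element point set $P$, $Q_P(f)=\frac1N\sum_{\boldsymbol{x}\in P}f(\boldsymbol{x})$, and the worst-case error is $e^{\mathrm{wor}}(H_{\alpha,\boldsymbol{\gamma}};Q_P)=\sup_{\|f\|_{\alpha,\boldsymbol{\gamma}}\le 1}|I(f)-Q_P(f)|$. Algorithm (inputs $\alpha,\boldsymbol{\gamma},r,M$): (1) draw $N$ uniformly from $\mathcal{P}_M=\{p \text{ prime}: \lceil M/2\rceil<p\le M\}$; (2) given $N$, draw $\boldsymbol{z}_1,\ldots,\boldsymbol{z}_r$ independently and uniformly from $\{1,\ldots,N-1\}^d$; (3) let $\boldsymbol{z}^*$ be a vector among $\boldsymbol{z}_1,\ldots,\boldsymbol{z}_r$ minimizing $e^{\mathrm{wor}}(H_{\alpha,\boldsymbol{\gamma}};Q_{P_{N,\boldsymbol{z}_j}})$ (ties broken by any fixed rule). The randomized rule $A^{\mathrm{ran}}_{r,M}$ is the random rule $Q_{P_{N,\boldsymbol{z}^*}}$. Its worst-case randomized error is $$e^{\mathrm{ran}}(H_{\alpha,\boldsymbol{\gamma}};A^{\mathrm{ran}}_{r,M})=\sup_{f\in H_{\alpha,\boldsymbol{\gamma}},\ \|f\|_{\alpha,\boldsymbol{\gamma}}\le 1}\mathbb{E}_{N,\boldsymbol{z}_1,\ldots,\boldsymbol{z}_r}\left[|I(f)-Q_{P_{N,\boldsymbol{z}^*}}(f)|\right].$$ *)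

(* Defs.v *)
From HB Require Import structures.
From mathcomp Require Import all_boot all_order all_algebra.
From mathcomp Require Import finmap complex.
From mathcomp Require Import all_classical all_reals all_analysis.
From mathcomp.analysis.showcase Require summability.

Set Implicit Arguments.
Unset Strict Implicit.
Unset Printing Implicit Defensive.
Import Order.TTheory GRing.Theory Num.Theory.
Import numFieldNormedType.Exports.
Local Open Scope classical_set_scope.
Local Open Scope complex_scope.
Local Open Scope ring_scope.

Section lebesgue_tuple.
Variable R : realType.

Definition tcons d (u : measurableTypeR R * d.-tuple (measurableTypeR R)) :
  d.+1.-tuple (measurableTypeR R) := [tuple of u.1 :: u.2].

Lemma measurable_tcons d : measurable_fun [set: _] (@tcons d).
Proof. exact: measurable_cons. Qed.

HB.instance Definition _ d :=
  isMeasurableFun.Build _ _ _ _ (@tcons d) (@measurable_tcons d).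

(* the product measure, transported along R * R^d -> R^(d+1) *)
Definition lebesgue_cons d
    (mu : {measure set (d.-tuple (measurableTypeR R)) -> \bar R}) :=
  pushforward (lebesgue_measure \x^ mu)%E (@tcons d).

Section lebesgue_cons_measure.
Variables (d : nat).
Variable mu : {measure set (d.-tuple (measurableTypeR R)) -> \bar R}.

Let lebesgue_cons0 : lebesgue_cons mu set0 = 0%E.
Proof. exact: measure0. Qed.

Let lebesgue_cons_ge0 A : (0 <= lebesgue_cons mu A)%E.
Proof. exact: measure_ge0. Qed.

Let lebesgue_cons_sigma_additive : semi_sigma_additive (lebesgue_cons mu).
Proof. exact: measure_semi_sigma_additive. Qed.

HB.instance Definition _ := isMeasure.Build _ _ _ (lebesgue_cons mu)
  lebesgue_cons0 lebesgue_cons_ge0 lebesgue_cons_sigma_additive.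

End lebesgue_cons_measure.

(* Lebesgue measure on R^d *)
Fixpoint lebesgue_tuple d :
    {measure set (d.-tuple (measurableTypeR R)) -> \bar R} :=
  match d with
  | 0 => dirac [tuple]
  | d'.+1 => lebesgue_cons (lebesgue_tuple d')
  end.

Definition unit_cube d : set (d.-tuple R) :=
  [set x | forall j, 0 <= tnth x j <= 1].

Definition cube_integral d (f : d.-tuple R -> R) : R :=
  \int[lebesgue_tuple d]_(x in @unit_cube d) f x.

Definition cube_cintegral d (f : d.-tuple R -> R[i]) : R[i] :=
  cube_integral (fun x => complex.Re (f x))
    +i* cube_integral (fun x => complex.Im (f x)).

End lebesgue_tuple.

(* sum of the Dirichlet series; only meaningful for 1 < s *)
Definition zeta (R : realType) (s : R) : R :=
  limn (series (fun n => n.+1%:R `^ (- s))).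

Section korobov.
Variables (R : realType) (d : nat).
Implicit Types (f : d.-tuple R -> R) (k : d.-tuple int) (x : d.-tuple R).

Definition dotp k x : R := \sum_(j < d) (tnth k j)%:~R * tnth x j.

Definition expi (t : R) : R[i] := cos t +i* sin t.

Definition fourier_char k x : R[i] := expi (2 * pi * dotp k x).

Definition fourier_coef f k : R[i] :=
  cube_cintegral (fun x => (f x)%:C * expi (- (2 * pi * dotp k x))).

(* f is a function on R^d: a one-periodic function on [0,1]^d is identified
   with its periodic extension *)
Definition one_periodic f := forall x y,
  (forall j, exists m : int, tnth y j = tnth x j + m%:~R) -> f y = f x.

Definition abs_cvg_fourier f :=
  summable [set: d.-tuple int]
    (fun k => (ComplexField.Normc.normc (fourier_coef f k))%:E) /\
  forall x, summability.partial_sum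
    (fun k => fourier_coef f k * fourier_char k x)
      @ summability.totally --> ((f x)%:C : R[i]^o).

Variables (alpha : R) (gamma : nat -> R).

(* the coordinate j : 'I_d is counted from 0, and so are the weights: the
   weight gamma_(j+1) of the literature is [gamma j] *)
Definition korobov_weight k : \bar R :=
  \big[*%E/1%E]_(j < d | tnth k j != 0)
    (if gamma j == 0 then +oo%E
     else (`|tnth k j|%:~R `^ alpha / gamma j)%:E).

Definition korobov_sqnorm f : \bar R :=
  \esum_(k in [set: d.-tuple int])
    ((ComplexField.Normc.normc (fourier_coef f k) ^+ 2)%:E
       * (korobov_weight k * korobov_weight k))%E.

Definition korobov : set (d.-tuple R -> R) := [set f |
  [/\ one_periodic f, abs_cvg_fourier f,
      forall k, korobov_weight k = +oo%E -> fourier_coef f k = 0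
    & (korobov_sqnorm f < +oo)%E]].

Definition korobov_norm f : R := Num.sqrt (fine (korobov_sqnorm f)).

Definition korobov_ball : set (d.-tuple R -> R) :=
  [set f | korobov f /\ korobov_norm f <= 1].

Definition equal_weight_rule N (P : 'I_N -> d.-tuple R) f : R :=
  N%:R^-1 * \sum_(n < N) f (P n).

Definition integration_error N (P : 'I_N -> d.-tuple R) f : R :=
  `|cube_integral f - equal_weight_rule P f|.

Definition wce N (P : 'I_N -> d.-tuple R) : \bar R :=
  ereal_sup [set (integration_error P f)%:E | f in korobov_ball].

Definition frac (t : R) : R := t - (Num.floor t)%:~R.

Definition lattice_points N (z : d.-tuple 'I_N) (n : 'I_N) : d.-tuple R :=
  [tuple frac ((n * tnth z j)%:R / N%:R) | j < d].

End korobov.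

Section algorithm.
Variables (R : realType) (d r M : nat).

(* (ceil (M / 2), M] *)
Definition prime_range : {set 'I_M.+1} :=
  [set p : 'I_M.+1 | prime p & (uphalf M < p)%N].

(* {1, ..., N - 1}^d *)
Definition generators N : {set d.-tuple 'I_N} :=
  [set z : d.-tuple 'I_N | [forall j, 0 < tnth z j]%N].

Definition draws N : {set r.-tuple (d.-tuple 'I_N)} :=
  [set zs : r.-tuple (d.-tuple 'I_N) |
    [forall i, tnth zs i \in generators N]].

(* a rule choosing, from N and z_1, ..., z_r, the index of z^* *)
Definition selection := forall N, r.-tuple (d.-tuple 'I_N) -> 'I_r.

Definition minimizing (alpha : R) (gamma : nat -> R) (sel : selection) :=
  forall N : 'I_M.+1, N \in prime_range -> forall zs, zs \in draws N ->
  forall i, (wce alpha gamma (lattice_points R (tnth zs (sel N zs)))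
             <= wce alpha gamma (lattice_points R (tnth zs i)))%E.

Definition uniform_mean (T : finType) (A : {set T}) (F : T -> R) : R :=
  #|A|%:R^-1 * \sum_(x in A) F x.

(* a uniform draw from [draws N] is r independent uniform draws from
   [generators N] *)
Definition expected_error (sel : selection) (f : d.-tuple R -> R) : R :=
  uniform_mean prime_range (fun N : 'I_M.+1 =>
    uniform_mean (draws N) (fun zs =>
      integration_error (lattice_points R (tnth zs (sel N zs))) f)).

Definition randomized_error (alpha : R) (gamma : nat -> R) (sel : selection) :
    \bar R :=
  ereal_sup [set (expected_error sel f)%:E
            | f in korobov_ball alpha gamma].

End algorithm.

(* Main.v *)
Require Import Defs.
From HB Require Import structures.
From mathcomp Require Import all_boot all_order all_algebra.
From mathcomp Require Import finmap complex.
From mathcomp Require Import all_classical all_reals all_analysis.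
From mathcomp Require Import measurable_realfun.
From mathcomp.analysis.showcase Require summability.
From mathcomp Require Import zify ring lra.

Set Implicit Arguments.
Unset Strict Implicit.
Unset Printing Implicit Defensive.
Import Order.TTheory GRing.Theory Num.Theory.
Import numFieldNormedType.Exports.
Local Open Scope classical_set_scope.
Local Open Scope ring_scope.
Local Open Scope complex_scope.

(** Write q(k) for the reciprocal of the weight r(k), with q(k) = 0 where r(k)
is infinite, P for the product of 1 + 2 gamma_j^(1/lambda) zeta(alpha/lambda),
which is the sum of q^(1/lambda) over all frequencies, and call a frequency k
dual for (N, z) when N divides k.z.  Averaging a character over the lattice
points gives 1 or 0 according as k is dual or not, so the error of a rule at f
is at most the sum of |f^(k)| over the nonzero dual k
([integration_error_le_dual]), and Cauchy-Schwarz against the norm turns bounds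
on sums of squares of q into error bounds ([korobov_ball_sum_le]).

For N prime a random generator makes a given k dual with probability at most
1/(N-1), unless N divides every k_j.  Hence the mean over z of the sum of
q^(1/lambda) over nonzero dual k is at most 3P/N, and by Markov's inequality a
generator is bad, meaning that its worst-case error exceeds the threshold
(3P/((1-eta)N))^lambda, with probability at most 1 - eta
([bad_fraction_le]).  If all r draws are bad, an event of probability at most
(1-eta)^r, the trivial Cauchy-Schwarz bound on the error gives the second term
of the estimate.

Otherwise the selected generator is good, since it minimizes the worst-case
error among draws one of which is good, and its error is at most the sum of the
errors of all good draws: the mean is at most r times the mean M0 over N and z
of the error restricted to good z ([selected_error_le]).  A good generator has
no short dual vectors: the function q(k) cos(2 pi k.x) lies in the unit ball and
is integrated with error q(k) when k is dual ([inv_weight_le_wce]), so a good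
generator only has dual k with q(k) below the threshold.  Thus M0 is at most the
sum of |f^(k)| Prob(k is dual) over nonzero k with q(k) below the threshold.

That probability is at most 4/M plus the fraction of the primes of the range
that divide some fixed nonzero coordinate k_j.  Few primes of the range divide
k_j, and if one does then |k_j| >= M/2; since the range holds at least a
constant times M^(1-e) primes, the fraction is at most
c |k_j|^(2e) / M ([prime_divisor_fraction_le]), and |k_j|^(2e) is at most
q(k)^(-delta/lambda) for a suitable e ([coord_powR_le]).  A last Cauchy-Schwarz
with these weights bounds M0 by
c' P^(lambda-delta) / ((1-eta)^(lambda-delta-1/2) M^(lambda-delta+1/2))
([good_mean_le], [good_mean_boundE]), which is the first term.

The count of primes follows Erdos's proof of Bertrand's postulate: in the
central binomial coefficient the primes up to sqrt(2n) contribute little, those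
up to 2n/3 at most 4^(2n/3), and those in (2n/3, n] nothing, so the primes in
(n, 2n] must account for the rest of 4^n ([expn4_le_primes]). *)

Local Notation cabs := ComplexField.Normc.normc.

(** * Primes in (n, 2n]: the central binomial coefficient *)

Section central_binomial.
Local Open Scope nat_scope.

Lemma bin_2n1 n : n.+1 * 'C(n.*2.+1, n) = n.*2.+1 * 'C(n.*2, n).
Proof. by have := mul_bin_down n.*2.+1 n => /= ->; congr (_ * _); lia. Qed.

Lemma bin_2n2 n : 'C(n.*2.+2, n.+1) = 2 * 'C(n.*2.+1, n).
Proof.
have := mul_bin_diag n.*2.+2 n => /= h.
apply/eqP; rewrite -(@eqn_pmul2l n.+1) // -h; apply/eqP; lia.
Qed.

(** The recurrence for central binomial coefficients multiplies them by
2(2n+1)/(n+1), almost 4; the factor 2n absorbs the loss. *)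
Lemma expn4_le_central_bin n : 0 < n -> 4 ^ n <= n.*2 * 'C(n.*2, n).
Proof.
case: n => // n _; elim: n => [|n IHn]; first by [].
rewrite doubleS bin_2n2 expnS.
have := bin_2n1 n.+1; rewrite doubleS in IHn *.
move: ('C(_, _)) IHn => c; move: ('C(_, _)) => c' IHn h.
by nia.
Qed.

(** Each step multiplies the left side by 2(2m+3)/(m+2) < 4. *)
Lemma bin_2n1_le m : 'C(m.*2.+1, m) <= 4 ^ m.
Proof.
elim: m => // m IHm.
have h := bin_2n1 m.+1; rewrite doubleS in h.
rewrite bin_2n2 in h.
rewrite -(@leq_pmul2l m.+2) // doubleS h expnS.
by move: IHm; move: ('C(_, _)) => c; move: (4 ^ m) => e; nia.
Qed.

Lemma prime_ndvd_fact p n : prime p -> n < p -> ~~ (p %| n`!).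
Proof.
move=> pp; elim: n => [|n IHn] np; first by rewrite fact0 dvdn1 neq_ltn prime_gt1 ?orbT.
by rewrite factS Euclid_dvdM // negb_or gtnNdvd //= IHn // ltnW.
Qed.

Lemma prod_primes_dvdn (s : seq nat) x :
  uniq s -> all prime s -> all (fun p => p %| x) s -> \prod_(p <- s) p %| x.
Proof.
elim: s => [|p s IHs] /=; first by rewrite big_nil dvd1n.
move=> /andP[ps us] /andP[pp ap] /andP[px ax].
rewrite big_cons Gauss_dvd ?px ?IHs //.
rewrite big_seq; apply: (big_ind (fun y => coprime p y)).
- exact: coprimen1.
- by move=> y z; rewrite coprimeMr => -> ->.
- move=> y ys; rewrite prime_coprime // dvdn_prime2 //; last exact: (allP ap).
  by apply: contra ps => /eqP ->.
Qed.

Definition primorial n := \prod_(0 <= p < n.+1 | prime p) p.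

(** For n = 2m+1, all primes in (m+1, 2m+1] divide 'C(2m+1, m), which is at
most 4^m, and induction handles the primes up to m+1; an even n > 2 is not prime. *)
Lemma primorial_le n : primorial n <= 4 ^ n.
Proof.
elim/ltn_ind: n => n IHn.
have [n2|n3] := leqP n 2.
  by case: n n2 IHn => [|[|[|]]] // _ _; rewrite /primorial unlock.
have [on|en] := boolP (odd n); last first.
  have np : ~~ prime n by apply: contra en => pn; case: (even_prime pn) => // n2; lia.
  rewrite /primorial big_mkcond big_nat_recr //= (negbTE np) muln1 -big_mkcond /=.
  case: n n3 IHn {en np} => // n n3 IHn.
  by rewrite (leq_trans (IHn n _)) // leq_exp2l.
have [m nE] : exists m, n = m.*2.+1 by exists n./2; lia.
have m0 : 0 < m by lia.
rewrite /primorial (@big_cat_nat _ _ _ m.+2) //=; last by lia.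
have -> : 4 ^ n = 4 ^ m.+1 * 4 ^ m by rewrite -expnD; congr (_ ^ _); lia.
apply: leq_mul; first by apply: IHn; lia.
apply: leq_trans (bin_2n1_le m); apply: dvdn_leq; first by rewrite bin_gt0; lia.
rewrite -big_filter; apply: prod_primes_dvdn.
- by rewrite filter_uniq ?iota_uniq.
- by apply/allP => p; rewrite mem_filter => /andP[].
- apply/allP => p; rewrite mem_filter mem_index_iota => /andP[pp /andP[mp pn]].
  have : p %| n`! by apply: dvdn_fact; rewrite prime_gt0 //=; lia.
  have -> : n`! = 'C(n, m) * (m`! * (n - m)`!) by rewrite bin_fact //; lia.
  rewrite !Euclid_dvdM // (negbTE (prime_ndvd_fact pp _)); last by lia.
  rewrite (negbTE (prime_ndvd_fact pp _)); last by lia.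
  by rewrite !orbF nE.
Qed.

Lemma logn_fact_split p n : prime p ->
  logn p (n.*2)`! = logn p 'C(n.*2, n) + (logn p n`!).*2.
Proof.
move=> pp; have n2 : n <= n.*2 by lia.
have -> : (n.*2)`! = 'C(n.*2, n) * (n`! * n`!).
  by rewrite -(bin_fact n2); congr (_ * (_ * _`!)); lia.
rewrite !lognM ?bin_gt0 ?muln_gt0 ?fact_gt0 //; lia.
Qed.

(** Legendre's formula with a common range of exponents, so that the sums
for n! and (2n)! can be compared term by term. *)
Lemma logn_fact_widen p n m : prime p -> n <= m ->
  logn p n`! = \sum_(1 <= k < m.+1) n %/ p ^ k.
Proof.
move=> pp nm; rewrite logn_fact // [RHS](@big_cat_nat _ _ _ n.+1) //=.
rewrite [X in _ = _ + X]big1_seq ?addn0 // => k.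
rewrite mem_index_iota => /and3P[_ nk _].
rewrite divn_small // (leq_ltn_trans _ (ltn_expl k (prime_gt1 pp))) //; lia.
Qed.

(** In Legendre's formula, 2n/p^k exceeds twice n/p^k (both rounded down)
by at most 1, and only when p^k <= 2n. *)
Lemma logn_central_bin_le p n : prime p -> 0 < n ->
  logn p 'C(n.*2, n) <= trunc_log p n.*2.
Proof.
move=> pp n0; have := logn_fact_split n pp.
have n2 : n <= n.*2 by lia.
rewrite (logn_fact_widen pp (leqnn _)) (logn_fact_widen pp n2).
set L := trunc_log _ _; set S := \sum_(1 <= k < _) n %/ _.
suff : \sum_(1 <= k < n.*2.+1) n.*2 %/ p ^ k <= S.*2 + L by lia.
have -> : S.*2 + L = \sum_(1 <= k < n.*2.+1) ((n %/ p ^ k).*2 + (k <= L)).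
  rewrite big_split /=; congr (_ + _).
    by rewrite /S -muln2 big_distrl /=; apply: eq_bigr => k _; rewrite muln2.
  have Ln : L <= n.*2.
    have := trunc_logP (prime_gt1 pp) (_ : 0 < n.*2).
    rewrite double_gt0 => /(_ n0); apply: leq_trans.
    by rewrite ltnW // ltn_expl // prime_gt1.
  rewrite (@big_cat_nat _ _ _ L.+1) //= [X in _ = _ + X]big1_seq; last first.
    by move=> k; rewrite mem_index_iota => /and3P[_ Lk _]; rewrite leqNgt Lk.
  rewrite addn0 (eq_big_nat _ _ (F2 := fun => 1)); last first.
    by move=> k /andP[_]; rewrite ltnS => ->.
  by rewrite sum_nat_const_nat muln1 subn1.
apply: leq_sum => k _; have p0 : 0 < p ^ k by rewrite expn_gt0 prime_gt0.
have [kL|kL] := leqP k L; last first.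
  rewrite divn_small // ltnNge; apply/negP => /(trunc_log_max (prime_gt1 pp)).
  by rewrite -/L; lia.
rewrite addn1 -ltnS ltn_divLR //.
have := divn_eq n (p ^ k); have := ltn_pmod n p0.
by move: (n %/ _) (n %% _) => a b; nia.
Qed.

Lemma pfactor_central_bin_le p n : prime p -> 0 < n ->
  p ^ logn p 'C(n.*2, n) <= n.*2.
Proof.
move=> pp n0; apply: (@leq_trans (p ^ trunc_log p n.*2)).
  by rewrite leq_exp2l ?prime_gt1 // logn_central_bin_le.
by apply: trunc_logP; rewrite ?prime_gt1 // double_gt0.
Qed.

Lemma logn_central_bin_le1 p n : prime p -> 0 < n -> n.*2 < p ^ 2 ->
  logn p 'C(n.*2, n) <= 1.
Proof.
move=> pp n0 np2; apply: leq_trans (logn_central_bin_le pp n0) _.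
rewrite -ltnS -(@ltn_exp2l p) ?prime_gt1 //; apply: leq_ltn_trans np2.
by apply: trunc_logP; rewrite ?prime_gt1 // double_gt0.
Qed.

(** Here p^2 > 2n, so only k = 1 matters in Legendre's formula: 2n/p and
n/p round down to 2 and 1, which cancel. *)
Lemma logn_central_bin_eq0 p n : prime p -> 2 < p -> n.*2 < 3 * p -> p <= n ->
  logn p 'C(n.*2, n) = 0.
Proof.
move=> pp p3 np pn; have := logn_fact_split n pp.
have n2 : n <= n.*2 by lia.
rewrite (logn_fact_widen pp (leqnn _)) (logn_fact_widen pp n2).
have E m : m < 3 * p -> 0 < n.*2 ->
    \sum_(1 <= k < n.*2.+1) m %/ p ^ k = m %/ p.
  move=> mp n0; rewrite big_ltn // expn1 big1_seq ?addn0 // => k.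
  rewrite mem_index_iota => /and3P[_ k2 _]; rewrite divn_small //.
  apply: leq_trans mp _; apply: (@leq_trans (p ^ 2)).
    by rewrite expnS expn1 leq_mul2r p3 orbT.
  by rewrite leq_exp2l // prime_gt1.
rewrite !E; try lia.
have -> : n %/ p = 1 by apply/eqP; rewrite eqn_leq -ltnS ltn_divLR ?leq_divRL; lia.
have -> : n.*2 %/ p = 2 by apply/eqP; rewrite eqn_leq -ltnS ltn_divLR ?leq_divRL; lia.
lia.
Qed.

Lemma sqrt_exists m : exists s, s * s <= m < s.+1 * s.+1.
Proof.
elim: m => [|m [s /andP[h1 h2]]]; first by exists 0.
have [h|h] := ltnP m.+1 (s.+1 * s.+1); first by exists s; lia.
by exists s.+1; nia.
Qed.

(** The factors f1, f2 and f3 below bound the p-parts of 'C(2n, n) for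
p <= sqrt(2n), for p <= 2n/3 and for p > n; no other prime contributes. *)
Lemma expn4_le_primes n s : 2 <= n -> s * s <= n.*2 < s.+1 * s.+1 ->
  4 ^ (n - n.*2 %/ 3) <=
  n.*2 ^ (s + (\sum_(0 <= p < n.*2.+1 | prime p && (n < p)) 1)).+1.
Proof.
move=> n2 /andP[s1 s2].
have n0 : 0 < n by lia.
set C := 'C(n.*2, n); set w := \sum_(_ <= _ < _ | _) 1.
have C0 : 0 < C by rewrite bin_gt0; lia.
pose f1 p := if 0 < p <= s then n.*2 else 1.
pose f2 p := if prime p && (p <= n.*2 %/ 3) then p else 1.
pose f3 p := if prime p && (n < p) then n.*2 else 1.
have CE : C = \prod_(0 <= p < n.*2.+1) p ^ logn p C.
  rewrite -{1}(partnT C0) (@widen_partn (maxn C n.*2)) ?leq_maxl //.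
  rewrite (@big_cat_nat _ _ _ n.*2.+1) //=; last by rewrite ltnS leq_maxr.
  rewrite [X in _ * X]big1_seq ?muln1 // => p; rewrite mem_index_iota => /and3P[_ np _].
  have [pp|npp] := boolP (prime p); last by rewrite lognE (negbTE npp).
  have := pfactor_central_bin_le pp n0; rewrite -/C.
  case: (logn p C) => // l; rewrite expnS => h.
  suff : p <= n.*2 by lia.
  by apply: leq_trans h; rewrite leq_pmulr // expn_gt0 prime_gt0.
have C1 : C <= \prod_(0 <= p < n.*2.+1) (f1 p * (f2 p * f3 p)).
  rewrite {1}CE; apply: leq_prod => p _.
  rewrite /f1 /f2 /f3.
  have [pp|] := boolP (prime p); last first.
    by move=> np; rewrite lognE (negbTE np) /= expn0 !muln1; case: ifP; lia.
  have p0 := prime_gt0 pp; rewrite p0 /=.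
  have [ps|sp] := leqP p s.
    apply: leq_trans (pfactor_central_bin_le pp n0) _.
    by rewrite leq_pmulr // muln_gt0; do 2 case: ifP => //=; lia.
  have np2 : n.*2 < p ^ 2.
    by rewrite -mulnn; apply: leq_trans s2 _; apply: leq_mul.
  have l1 := logn_central_bin_le1 pp n0 np2.
  rewrite mul1n.
  have pl : p ^ logn p C <= p.
    by rewrite -[leqRHS]expn1 leq_exp2l // prime_gt1.
  have [pm|mp] := leqP p (n.*2 %/ 3).
    by apply: leq_trans pl _; rewrite leq_pmulr //; case: ifP => //; lia.
  rewrite mul1n; have [np|pn] := ltnP n p.
    exact: pfactor_central_bin_le.
  have h3 : n.*2 < 3 * p by rewrite mulnC -ltn_divLR.
  have [p3|p2] := ltnP 2 p; first by rewrite logn_central_bin_eq0.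
  have : p = 2 by have := prime_gt1 pp; lia.
  by move=> pE; rewrite pE /= in np2 h3 *; lia.
have P1 : \prod_(0 <= p < n.*2.+1) f1 p <= n.*2 ^ s.
  have sn : s <= n.*2 by apply: leq_trans s1; nia.
  rewrite big_ltn // {1}/f1 /= mul1n (@big_cat_nat _ _ _ s.+1) //=.
  rewrite [X in _ * X]big1_seq ?muln1; last first.
    move=> p; rewrite mem_index_iota => /and3P[_ h _]; rewrite /f1 ifF //.
    by rewrite [p <= _]leqNgt h andbF.
  rewrite (eq_big_nat _ _ (F2 := fun => n.*2)); last first.
    by move=> p /andP[p0]; rewrite ltnS /f1 p0 => ->.
  by rewrite prod_nat_const_nat subn1.
have P2 : \prod_(0 <= p < n.*2.+1) f2 p <= 4 ^ (n.*2 %/ 3).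
  apply: leq_trans (primorial_le _); rewrite /primorial.
  rewrite (@big_cat_nat _ _ _ (n.*2 %/ 3).+1) //=; last first.
    by rewrite ltnS leq_div.
  rewrite [X in _ * X]big1_seq ?muln1; last first.
    move=> p; rewrite mem_index_iota => /and3P[_ h _]; rewrite /f2 ifF //.
    by rewrite [p <= _]leqNgt h andbF.
  rewrite [leqRHS]big_mkcond /= !big_nat; apply: leq_prod => p /andP[_ h].
  by rewrite ltnS in h; rewrite /f2 h andbT.
have P3 : \prod_(0 <= p < n.*2.+1) f3 p = n.*2 ^ w.
  rewrite /f3 -big_mkcond /= /w; elim/big_rec2: _ => // p a b _ ->.
  by rewrite addnC addn1 expnS.
have := expn4_le_central_bin n0; rewrite -/C => H.
have {}C1 : C <= n.*2 ^ s * (4 ^ (n.*2 %/ 3) * n.*2 ^ w).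
  by apply: leq_trans C1 _; rewrite !big_split /= P3 leq_mul // leq_mul.
rewrite -(@leq_pmul2l (4 ^ (n.*2 %/ 3))) ?expn_gt0 // -expnD.
rewrite subnKC ?leq_div //; last by lia.
apply: leq_trans H _; rewrite expnS expnD mulnCA.
by rewrite leq_mul2l mulnCA C1 orbT.
Qed.

End central_binomial.

(** * How often a prime of the range divides an integer *)

Section primes_in_range.
Variable R : realType.

Lemma card_prime_rangeE M :
  #|prime_range M| = (\sum_(0 <= p < M.+1 | prime p && (uphalf M < p)) 1)%N.
Proof.
by rewrite -sum1_card big_mkord; apply: eq_bigl => p; rewrite inE.
Qed.

Lemma uphalf_gap M : (M <= (uphalf M - (uphalf M).*2 %/ 3) * 6)%N.
Proof. lia. Qed.

(** Apply ln x <= x to x = y^e. *)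
Lemma ln_le_powR (e y : R) : 0 < e -> 0 < y -> ln y <= y `^ e / e.
Proof.
move=> e0 y0; rewrite ler_pdivlMr // mulrC -ln_powR.
have h : 0 < y `^ e by exact: powR_gt0.
by have := @ln_sublinear R _ h; exact: ltW.
Qed.

(** With n the upper half of M, the range (n, M] contains the same primes as
(n, 2n], because 2n is M or the even number M + 1. *)
Lemma expn4_le_card_prime_range M : (3 <= M)%N ->
  exists2 s, (s * s <= M.+1)%N &
    (4 ^ (uphalf M - (uphalf M).*2 %/ 3) <= M.+1 ^ (s + #|prime_range M|).+1)%N.
Proof.
move=> M3; set n := uphalf M; have [s hs] := sqrt_exists n.*2.
have n2 : (2 <= n)%N by rewrite /n; lia.
exists s; first by have /andP[h _] := hs; apply: leq_trans h _; rewrite /n; lia.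
apply: leq_trans (expn4_le_primes n2 hs) _.
have -> : (\sum_(0 <= p < n.*2.+1 | prime p && (n < p)) 1)%N = #|prime_range M|.
  rewrite card_prime_rangeE -/n.
  have [->//|ME] : n.*2 = M \/ n.*2 = M.+1 by rewrite /n; lia.
  rewrite ME big_mkcond big_nat_recr //= -big_mkcond /= ifF ?addn0 //.
  apply/negbTE; rewrite -ME negb_and; apply/orP; left; apply/negP => pp.
  by have [] := even_prime pp; lia.
by rewrite leq_exp2r //; rewrite /n; lia.
Qed.

(** By the previous bound and ln M = O(M^e), the number of primes plus
3 sqrt(M) is at least a M^(1-e).  As 1 - e > 1/2, either M is so large that
sqrt(M) is negligible, or M is bounded and one prime suffices. *)
Lemma card_prime_range_ge (e : R) : 0 < e -> e < 2^-1 ->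
  exists2 c : R, 0 < c & forall M, (2 <= M)%N -> (0 < #|prime_range M|)%N ->
    c * M%:R `^ (1 - e) <= #|prime_range M|%:R.
Proof.
move=> e0 e2; pose a : R := e / 24; pose th : R := 2^-1 - e.
have th0 : 0 < th by rewrite /th; lra.
have a0 : 0 < a by rewrite /a divr_gt0.
pose K := (6 / a) `^ ((1 - e) / th).
have K0 : 0 < K by rewrite powR_gt0 // divr_gt0.
exists (Num.min (a / 2) K^-1) => [|M M2 P0].
  by rewrite lt_min divr_gt0 //= invr_gt0.
have M2M : (M.+1 <= 2 * M)%N by lia.
have Mpos : 0 < M%:R :> R by rewrite ltr0n; lia.
have M1 : 1 <= M%:R :> R by rewrite ler1n; lia.
have P1 : 1 <= #|prime_range M|%:R :> R by rewrite ler1n.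
set x := M%:R `^ (1 - e).
have x0 : 0 < x by rewrite powR_gt0.
(* 6/a is where 3 sqrt(M) becomes half of a M^(1-e) *)
have [small|large] := ltP (M%:R `^ th) (6 / a).
  apply: le_trans P1; apply: (@le_trans _ _ (K^-1 * x)).
    by rewrite ler_wpM2r ?ge_min ?lexx ?orbT // ltW.
  rewrite mulrC ler_pdivrMr // mul1r /x.
  have -> : 1 - e = th * ((1 - e) / th) by rewrite mulrCA mulfV ?mulr1 // gt_eqF.
  rewrite powRrM /K; apply: ge0_ler_powR; rewrite ?nnegrE ?powR_ge0 //.
  - by rewrite divr_ge0 // ?ltW //; lra.
  - by rewrite divr_ge0 // ltW.
  - exact: ltW.
have [M3|M3] := leqP 3 M; last first.
  have ME : M = 2%N by apply/eqP; rewrite eqn_leq M2 -ltnS M3.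
  apply: le_trans P1; apply: (@le_trans _ _ (a / 2 * x)).
    by rewrite ler_wpM2r ?ge_min ?lexx // ltW.
  have : x <= 2.
    rewrite /x ME -[leRHS](powRr1 (a := 2)) //; apply: ler_powR; rewrite ?ler1n //; lra.
  by rewrite /a; nra.
apply: (@le_trans _ _ (a / 2 * x)); first by rewrite ler_wpM2r ?ge_min ?lexx // ltW.
have [s s2] := expn4_le_card_prime_range M3.
set P := #|prime_range M| in P1 *; set n := uphalf M => H.
have L0 : 0 <= ln (M.+1%:R : R) by apply: ln_ge0; rewrite ler1n.
have H1 : (n - n.*2 %/ 3)%:R * ln (4 : R) <= (s + P).+1%:R * ln (M.+1%:R : R).
  have : ln ((4 ^ (n - n.*2 %/ 3))%:R : R) <= ln ((M.+1 ^ (s + P).+1)%:R : R).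
    by rewrite ler_ln ?posrE ?ltr0n ?expn_gt0 // ler_nat.
  by rewrite !natrX !lnXn ?ltr0n // !mulr_natl.
have ln4 : 2^-1 <= ln (4 : R).
  have := @le_ln1Dx R (4^-1 - 1).
  have -> : 1 + (4^-1 - 1) = 4^-1 :> R by lra.
  have h4 : -1 < 4^-1 - 1 :> R by lra.
  by move=> /(_ h4); rewrite lnV ?posrE //; lra.
have n6 : M%:R / 6 <= (n - n.*2 %/ 3)%:R :> R.
  by rewrite ler_pdivrMr // -natrM ler_nat uphalf_gap.
have lnM : ln (M.+1%:R : R) <= 2 * M%:R `^ e / e.
  apply: (le_trans (ln_le_powR e0 _)); first by rewrite ltr0n.
  rewrite ler_pM2r ?invr_gt0 //.
  apply: (@le_trans _ _ ((2 * M%:R) `^ e)).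
    apply: ge0_ler_powR; rewrite ?nnegrE //; first exact: ltW.
    by rewrite -natrM ler_nat.
  rewrite powRM // ler_wpM2r ?powR_ge0 //.
  by rewrite -[leRHS](powRr1 (a := 2)) //; apply: ler_powR; rewrite ?ler1n //; lra.
set t : R := M%:R `^ 2^-1.
have t0 : 0 <= t by exact: powR_ge0.
have tt : t * t = M%:R by rewrite /t powR12_sqrt ?ler0n // -expr2 sqr_sqrtr // ler0n.
have sM : (s.+1)%:R <= 3 * t.
  have : s%:R * s%:R <= t * t + 1 by rewrite tt -natrM natr1 ler_nat.
  have : 0 <= s%:R :> R by rewrite ler0n.
  rewrite -natr1; move: (s%:R : R) => u u0 h.
  have t1 : 1 <= t by nra.
  by nra.
have xE : x * M%:R `^ e = M%:R.
  by rewrite /x -powRD ?subrK ?powRr1 // ?(gt_eqF Mpos) ?implybT.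
have xE2 : x = t * M%:R `^ th.
  rewrite /x /t -powRD; last by rewrite (gt_eqF Mpos) implybT.
  by congr (_ `^ _); rewrite /th; lra.
have y0 : 0 < M%:R `^ e by rewrite powR_gt0.
have {}H : a * x <= (s + P).+1%:R.
  rewrite -(ler_pM2r y0) -mulrA xE.
  have sP0 : 0 <= (s + P).+1%:R :> R by rewrite ler0n.
  have h1 : M%:R / 6 * 2^-1 <= (n - n.*2 %/ 3)%:R * ln (4 : R).
    by apply: ler_pM => //; rewrite ?divr_ge0 ?invr_ge0 ?ler0n.
  have h2 := ler_wpM2l sP0 lnM.
  have h3 : M%:R / 6 * 2^-1 <= (s + P).+1%:R * (2 * M%:R `^ e / e) by lra.
  have := ler_wpM2r (ltW e0) h3; rewrite -!mulrA [e^-1 * e]mulVf ?gt_eqF //.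
  by rewrite /a; lra.
have h4 : 3 * t <= a / 2 * x.
  have : 6 <= a * M%:R `^ th by rewrite mulrC -ler_pdivrMr.
  by rewrite xE2 => h5; have := ler_wpM2l t0 h5; lra.
have : (s + P).+1%:R = s.+1%:R + P%:R :> R by rewrite -natrD addSn.
lra.
Qed.

(** Distinct primes dividing m have a product, at least 2 to their number,
that divides m. *)
Lemma card_prime_divisors_le (e : R) M m : 0 < e -> (0 < m)%N ->
  #|finset (fun p : 'I_M.+1 => (p \in prime_range M) && (p %| m)%N)|%:R
    <= m%:R `^ e / (e * ln 2).
Proof.
move=> e0 m0; set D := finset _.
have l2 : 0 < ln (2 : R) by rewrite ln_gt0 // ltr1n.
have h : (2 ^ #|D| <= m)%N.
  have h0 : (2 ^ #|D| <= \prod_(p <- [seq val p | p in D]) p)%N;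
    last (apply: (leq_trans h0)).
    rewrite big_image /= -prod_nat_const; apply: leq_prod => p.
    by rewrite !inE => /andP[/andP[pp _] _]; exact: prime_gt1.
  apply: dvdn_leq => //; apply: prod_primes_dvdn.
  - by rewrite map_inj_uniq ?enum_uniq //; exact: val_inj.
  - apply/allP => y /mapP[p pD ->]; move: pD; rewrite mem_enum !inE.
    by move=> /andP[/andP[]].
  - apply/allP => y /mapP[p pD ->]; move: pD; rewrite mem_enum !inE.
    by move=> /andP[].
have h1 : #|D|%:R * ln 2 <= ln (m%:R : R).
  rewrite mulr_natl -lnXn // -natrX ler_ln ?posrE ?ltr0n ?expn_gt0 //.
  by rewrite ler_nat.
rewrite invfM mulrA ler_pdivlMr //; apply: le_trans h1 _.
by apply: ln_le_powR; rewrite ?ltr0n.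
Qed.

(** If some prime of the range divides m then M <= 2m, so the loss M^e in
the count of primes can be paid for by m^e. *)
Lemma prime_divisor_fraction_le (e : R) : 0 < e -> e < 2^-1 ->
  exists2 c : R, 0 < c & forall M m, (2 <= M)%N -> (0 < m)%N ->
    #|finset (fun p : 'I_M.+1 => (p \in prime_range M) && (p %| m)%N)|%:R
      / #|prime_range M|%:R <= c * m%:R `^ (e + e) / M%:R.
Proof.
move=> e0 e2; have [c c0 hc] := card_prime_range_ge e0 e2.
have l2 : 0 < ln (2 : R) by rewrite ln_gt0 // ltr1n.
exists (2 / (c * (e * ln 2))) => [|M m M2 m0].
  by rewrite divr_gt0 // !mulr_gt0.
set D := finset _.
have Mpos : 0 < M%:R :> R by rewrite ltr0n; lia.
have mpos : 0 < m%:R :> R by rewrite ltr0n.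
have rhs0 : 0 <= 2 / (c * (e * ln 2)) * m%:R `^ (e + e) / M%:R.
  by rewrite !mulr_ge0 ?powR_ge0 ?invr_ge0 ?ler0n // !mulr_ge0 // ltW.
have [->|[p pD]] := set_0Vmem D; first by rewrite cards0 mul0r.
have P0 : (0 < #|prime_range M|)%N.
  by apply/card_gt0P; exists p; move: pD; rewrite inE => /andP[].
have Mm : (M <= 2 * m)%N.
  move: pD; rewrite !inE => /andP[/andP[_ Mp] pm].
  by have := dvdn_leq m0 pm; lia.
rewrite ler_pdivrMr ?ltr0n //.
have hD := card_prime_divisors_le M e0 m0; rewrite -/D in hD.
have {}hc := hc M M2 P0.
apply: (le_trans hD).
have hM : M%:R `^ e <= 2 * m%:R `^ e :> R.
  apply: (@le_trans _ _ ((2 * m%:R) `^ e)).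
    apply: ge0_ler_powR; rewrite ?nnegrE ?mulr_ge0 //; first exact: ltW.
    by rewrite -natrM ler_nat.
  rewrite powRM // ler_wpM2r ?powR_ge0 //.
  by rewrite -[leRHS](powRr1 (a := 2)) //; apply: ler_powR; rewrite ?ler1n //; lra.
apply: (@le_trans _ _ (2 / (c * (e * ln 2)) * m%:R `^ (e + e) / M%:R
    * (c * M%:R `^ (1 - e)))); last first.
  exact: ler_wpM2l.
have ME : M%:R = M%:R `^ (1 - e) * M%:R `^ e.
  by rewrite -powRD ?subrK ?powRr1 // ?(gt_eqF Mpos) ?implybT.
have mE : m%:R `^ (e + e) = m%:R `^ e * m%:R `^ e.
  by rewrite powRD // (gt_eqF mpos) implybT.
have y0 : 0 < M%:R `^ (1 - e) by rewrite powR_gt0.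
have w0 : 0 < M%:R `^ e by rewrite powR_gt0.
have v0 : 0 < m%:R `^ e by rewrite powR_gt0.
have -> : 2 / (c * (e * ln 2)) * m%:R `^ (e + e) / M%:R * (c * M%:R `^ (1 - e)) =
   m%:R `^ e / (e * ln 2) * ((2 * m%:R `^ e) / M%:R `^ e).
  rewrite mE; move: y0 w0 v0 ME {mE}.
  set y := M%:R `^ (1 - e); set w := M%:R `^ e; set v := m%:R `^ e.
  move=> y0 w0 v0 ->; field.
  by rewrite !gt_eqF.
apply: ler_peMr; last by rewrite ler_pdivlMr ?mul1r.
by rewrite divr_ge0 ?mulr_ge0 // ltW.
Qed.

End primes_in_range.

(** * Iterated integrals over the unit cube *)

Section cube_integral.
Variable R : realType.
Local Notation mu := (@lebesgue_measure R).

Lemma preimage_unit_cube d :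
  @tcons R d @^-1` (@unit_cube R d.+1) = `[0, 1]%classic `*` (@unit_cube R d).
Proof.
apply/seteqP; split => [[x u]|[x u]] /=; rewrite /unit_cube /tcons /=.
  move=> h; split; first by have := h ord0; rewrite in_itv /= (tnth_nth 0).
  by move=> j; have := h (lift ord0 j); rewrite !(tnth_nth 0).
rewrite in_itv /= => -[x01 u01] j.
case: (unliftP ord0 j) => [i|] ->; last by rewrite (tnth_nth 0).
by have := u01 i; rewrite !(tnth_nth 0).
Qed.

Lemma measurable_unit_cube d : measurable (@unit_cube R d).
Proof.
have -> : @unit_cube R d = \bigcap_(j in [set: 'I_d])
    ((fun x : d.-tuple (measurableTypeR R) => tnth x j) @^-1` `[0, 1]%classic).
  apply/seteqP; split => x /=; first by move=> h j _ /=; rewrite in_itv /=.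
  by move=> h j; have := h j I; rewrite /= in_itv.
apply: fin_bigcap_measurable => // j _; rewrite -[X in measurable X]setTI.
exact: measurable_tnth.
Qed.

(** Needed because Fubini's theorem asks for a sigma-finite second
factor. *)
Lemma lebesgue_cons_sigma_finite d
    (m2 : {measure set (d.-tuple (measurableTypeR R)) -> \bar R}) :
  sigma_finite setT m2 -> sigma_finite setT (lebesgue_cons m2).
Proof.
move=> /sigma_finiteP[G [TG ndG Goo]].
have /sigma_finiteP[F [TF ndF Foo]] := @sigma_finiteT _ _ _ mu.
pose hd (x : d.+1.-tuple (measurableTypeR R)) := thead x.
pose tl (x : d.+1.-tuple (measurableTypeR R)) := [tuple of behead x].
exists (fun n => hd @^-1` F n `&` tl @^-1` G n).
  apply/seteqP; split => // x _.
  have : [set: measurableTypeR R] (hd x) by [].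
  rewrite TF => -[n _ Fn].
  have : [set: d.-tuple (measurableTypeR R)] (tl x) by [].
  rewrite TG => -[k _ Gk].
  exists (maxn n k) => //; split.
    by have /subsetPset := ndF _ _ (leq_maxl n k); exact.
  by have /subsetPset := ndG _ _ (leq_maxr n k); exact.
move=> n; have [mF Fn] := Foo n; have [mG Gn] := Goo n; split.
  apply: measurableI; rewrite -[X in measurable X]setTI.
    exact: measurable_tnth.
  exact: measurable_behead.
rewrite /lebesgue_cons /pushforward.
have -> : @tcons R d @^-1` (hd @^-1` F n `&` tl @^-1` G n) = F n `*` G n.
  apply/seteqP; split => -[x u] /= [].
    rewrite /hd /tl /tcons /= theadE => ? h; split => //.
    by move: h; congr (G n _); exact/val_inj.
  rewrite /hd /tl /tcons /= theadE => ? h; split => //.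
  by move: h; congr (G n _); exact/val_inj.
by rewrite product_measure2E// lte_mul_pinfty// ge0_fin_numE.
Qed.

Lemma lebesgue_tuple_sigma_finite d : sigma_finite setT (lebesgue_tuple R d).
Proof.
elim: d => [|d IHd] /=; last exact: lebesgue_cons_sigma_finite.
apply: fin_num_fun_sigma_finite; last by move=> U mU; rewrite diracE.
  by rewrite measure0.
Qed.

Lemma lebesgue_tuple_unit_cube d : (lebesgue_tuple R d (@unit_cube R d) = 1)%E.
Proof.
elim: d => [|d IHd] /=.
  by rewrite diracE mem_set // => -[].
rewrite /lebesgue_cons /pushforward preimage_unit_cube product_measure2E //.
  have m1 : mu `[0, 1]%classic = 1%E.
    by rewrite lebesgue_measure_itv /= lte_fin ltr01 oppr0 adde0.
  rewrite [X in (X * _)%E]m1 mul1e.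
  exact: IHd.
exact: measurable_unit_cube.
Qed.

Lemma cube_integral_cons d (f : d.+1.-tuple R -> R) :
  measurable_fun setT (f : d.+1.-tuple (measurableTypeR R) -> measurableTypeR R) ->
  (forall x, `|f x| <= 1) ->
  cube_integral f = \int[mu]_(x in `[0, 1]%classic)
     cube_integral (fun u : d.-tuple R => f [tuple of x :: u]).
Proof.
move=> mf f1.
pose m2 := lebesgue_tuple R d.
pose H1 := isSFinite.Build _ _ _ _
  (sfinite_measure_sigma_finite (lebesgue_tuple_sigma_finite d)).
pose H2 := isSigmaFinite.Build _ _ _ _ (lebesgue_tuple_sigma_finite d).
(* the same measure, packed with its sigma-finiteness for Fubini's theorem *)
pose m2' := HB.pack_for
  {sigma_finite_measure set (d.-tuple (measurableTypeR R)) -> \bar R}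
  (Measure.sort m2) H1 H2.
have mC := @measurable_unit_cube d.
have mC1 := @measurable_unit_cube d.+1.
have mI : measurable (`[0%R : R, 1%R]%classic : set (measurableTypeR R)).
  exact: measurable_itv.
have m1 : mu `[0, 1]%classic = 1%E.
  by rewrite lebesgue_measure_itv /= lte_fin ltr01 oppr0 adde0.
have mft : measurable_fun setT (f \o @tcons R d).
  exact: measurableT_comp mf (@measurable_tcons R d).
have intf : (mu \x^ m2)%E.-integrable (`[0, 1]%classic `*` @unit_cube R d)
    (EFin \o (f \o @tcons R d)).
  apply: measurable_bounded_integrable.
  - exact: measurableX.
  - have := product_measure2E mu m2 mI mC; rewrite [X in (X * _)%E]m1 mul1e.
    rewrite [X in _ = X]lebesgue_tuple_unit_cube => h.
    have : (1%:E < +oo :> \bar R)%E by rewrite ltry.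
    by rewrite -h.
  - exact: measurable_funTS.
  - exists 1; split; first exact: num_real.
    by move=> y y1 u _ /=; rewrite (le_trans (f1 _)) // ltW.
rewrite /cube_integral /Rintegral; congr fine.
rewrite [LHS]integral_pushforward //; first last.
- by rewrite preimage_unit_cube.
- by apply/measurable_realfun.measurable_EFinP.
rewrite preimage_unit_cube integral_mkcond.
pose F : measurableTypeR R * d.-tuple (measurableTypeR R) -> \bar R :=
  (EFin \o (f \o @tcons R d)) \_ (`[0, 1]%classic `*` @unit_cube R d).
have intF : (mu \x m2')%E.-integrable setT F.
  apply/(integrable_mkcond _ _).1; first exact: measurableX.
  apply: measurable_bounded_integrable.
  - exact: measurableX.
  - have := product_measure1E mu m2' mI mC; rewrite [X in (X * _)%E]m1 mul1e.
    rewrite [X in _ = X]lebesgue_tuple_unit_cube => h.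
    have : (1%:E < +oo :> \bar R)%E by rewrite ltry.
    by rewrite -h.
  - exact: measurable_funTS.
  - exists 1; split; first exact: num_real.
    by move=> y y1 u _ /=; rewrite (le_trans (f1 _)) // ltW.
transitivity (\int[mu]_x (\int[m2]_y F (x, y))%E)%E.
  exact: (esym (@integral12_prod_meas2 _ _ _ _ R mu m2' _ intF)).
rewrite [RHS]integral_mkcond; apply: eq_integral => x _.
rewrite /F patchE; case: ifPn => xI; last first.
  apply: integral0_eq => y _; rewrite patchE ifF //.
  by apply/negbTE/negP => /set_mem h; move/negP: xI; apply; apply/mem_set; case: h.
transitivity (\int[m2]_(y in @unit_cube R d) (f [tuple of x :: y])%:E)%E.
  rewrite [RHS]integral_mkcond; apply: eq_integral => y _.
  rewrite !patchE; congr (if _ then _ else _).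
  apply/idP/idP => [/set_mem [_ h]|/set_mem h]; apply/mem_set => //.
  by split => //; exact/set_mem.
rewrite fineK //; apply: integrable_fin_num => //.
apply: measurable_bounded_integrable => //.
- by rewrite [X in (X < _)%E]lebesgue_tuple_unit_cube ltry.
- apply: measurable_funTS.
  apply: (measurableT_comp mf (f := f)
    (g := fun y : d.-tuple (measurableTypeR R) => [tuple of x :: y])).
  by apply: measurable_cons => //.
- exists 1; split; first exact: num_real.
  by move=> y y1 u _ /=; rewrite (le_trans (f1 _)) // ltW.
Qed.

End cube_integral.

(** * Integrals of cosines over the unit cube *)

Section characters.
Variable R : realType.
Local Notation mu := (@lebesgue_measure R).

Lemma cosD2piz (x : R) (m : int) : cos (x + 2 * pi * m%:~R) = cos x.
Proof.
have h (n : nat) y : cos (y + 2 * pi * n%:R) = cos y :> R.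
  by rewrite mulr_natr mulr_natl (periodicn (@cosD2pi R)).
case: m => n; first exact: h.
by rewrite NegzE mulrNz mulrN -[LHS](h n.+1) -pmulrn subrK.
Qed.

Lemma sinD2piz (x : R) (m : int) : sin (x + 2 * pi * m%:~R) = sin x.
Proof. by rewrite -!cosBpihalf addrAC cosD2piz. Qed.

Lemma Rintegral_cos_period (m : int) (th : R) : m != 0 ->
  \int[mu]_(x in `[0, 1]%classic) cos (2 * pi * (m%:~R * x) + th) = 0.
Proof.
move=> m0.
pose c : R := 2 * pi * m%:~R.
have c0 : c != 0 by rewrite !mulf_neq0 ?intr_eq0 // gt_eqF // pi_gt0.
pose F (x : R) := c^-1 * sin (c * x + th).
have dF (x : R) : is_derive x 1 F (cos (c * x + th)).
  apply: is_derive_eq; rewrite /GRing.scale /= addr0 mulr1.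
  by field.
have cF : continuous F.
  by move=> x; apply/differentiable_continuous/derivable1_diffP; case: (dF x).
rewrite /Rintegral.
under eq_integral do rewrite mulrA -/c.
rewrite (@continuous_FTC2 _ _ F) //.
- rewrite /F mulr0 add0r mulr1 -EFinB /= /c.
  rewrite [_ + th]addrC -mulrBr.
  by rewrite sinD2piz subrr mulr0.
- apply: continuous_subspaceT => x.
  apply: continuous_comp; last exact: continuous_cos.
  by apply: cvgD; [apply: cvgM; [exact: cvg_cst|exact: cvg_id]|exact: cvg_cst].
- split => //.
  + by apply: cvg_at_right_filter; exact: cF.
  + by apply: cvg_at_left_filter; exact: cF.
- by move=> x _; rewrite derive1E; case: (dF x).
Qed.

Lemma measurable_cos_dotp d (k : d.-tuple int) (th : R) :
  measurable_fun setT
    ((fun x => cos (2 * pi * dotp k x + th)) :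
      d.-tuple (measurableTypeR R) -> measurableTypeR R).
Proof.
have mc : measurable_fun setT (cos : measurableTypeR R -> measurableTypeR R).
  by apply: continuous_measurable_fun; exact: continuous_cos.
apply: (measurableT_comp mc).
apply: (@measurable_funD _ _ _ _ (fun x => 2 * pi * dotp k x) (fun=> th)).
  2: exact: measurable_cst.
apply: (@measurable_funM _ _ _ _ (fun=> 2 * pi)); first exact: measurable_cst.
rewrite /dotp; apply: measurable_sum => j.
apply: measurable_funM; first exact: measurable_cst.
exact: measurable_tnth.
Qed.

Lemma dotp_cons d (k : d.+1.-tuple int) (x : R) (u : d.-tuple R) :
  dotp k [tuple of x :: u] =
  (thead k)%:~R * x + dotp [tuple of behead k] u.
Proof.
rewrite /dotp big_ord_recl /= tnth0; congr (_ + _).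
apply: eq_bigr => j _; rewrite tnthS; congr (_%:~R * _).
by rewrite [in LHS](tuple_eta k) tnthS.
Qed.

(** By induction on d, integrating one coordinate at a time; carrying an
arbitrary phase th makes the statement stable under splitting off a coordinate,
and covers sines with th = -pi/2. *)
Lemma cube_integral_cos d (k : d.-tuple int) (th : R) :
  cube_integral (fun x : d.-tuple R => cos (2 * pi * dotp k x + th)) =
  if [forall j, tnth k j == 0] then cos th else 0.
Proof.
elim: d k th => [|d IHd] k th.
  rewrite ifT; last by apply/forallP => -[].
  rewrite /cube_integral /Rintegral /= integral_dirac /=; first last.
  - apply/measurable_EFinP; apply: measurable_funTS.
    exact: measurable_cos_dotp.
  - exact: measurable_unit_cube.
  rewrite indicE mem_set ?mul1r /=; last by move=> [].
  by rewrite /dotp big_ord0 mulr0 add0r.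
rewrite cube_integral_cons; last 2 first.
- exact: measurable_cos_dotp.
- by move=> x; exact: cos_max.
have E (x : R) : cube_integral (fun u : d.-tuple R =>
      cos (2 * pi * dotp k [tuple of x :: u] + th)) =
    if [forall j, tnth [tuple of behead k] j == 0]
    then cos (2 * pi * ((thead k)%:~R * x) + th) else 0.
  rewrite -IHd; congr cube_integral; apply/funext => u.
  by rewrite dotp_cons mulrDr -addrA [X in cos X]addrCA addrA.
under eq_Rintegral do rewrite E.
have -> : [forall j, tnth k j == 0] =
    (thead k == 0) && [forall j, tnth [tuple of behead k] j == 0].
  apply/forallP/andP => [h|[h0 /forallP h] j].
    split; first exact: h.
    apply/forallP => j; rewrite -(eqP (h (lift ord0 j))).
    by rewrite [in X in _ == X](tuple_eta k) tnthS.
  by case: (unliftP ord0 j) => [i|] ->; rewrite (tuple_eta k) ?tnthS ?tnth0.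
case: [forall j, _]; last by rewrite andbF Rintegral_cst // mul0r.
rewrite andbT; case: eqVneq => [->|k0]; last exact: Rintegral_cos_period.
have m1 : mu `[0, 1]%classic = 1%E.
  by rewrite lebesgue_measure_itv /= lte_fin ltr01 oppr0 adde0.
under eq_Rintegral do rewrite mul0r mulr0 add0r.
rewrite Rintegral_cst // [X in fine X](_ : _ = 1%E) ?mulr1 //; exact: m1.
Qed.

End characters.

(** * Characters on lattice points *)

Section lattice_characters.
Variable R : realType.

Lemma expiD (a b : R) : expi (a + b) = expi a * expi b.
Proof.
rewrite /expi cosD sinD; apply/eqP; rewrite eq_complex /=.
by rewrite eqxx addrC eqxx.
Qed.

Lemma expi0 : expi (0 : R) = 1.
Proof. by rewrite /expi cos0 sin0. Qed.

Lemma expi_mulrn (a : R) n : expi (n%:R * a) = expi a ^+ n.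
Proof.
elim: n => [|n IHn]; first by rewrite mul0r expi0.
by rewrite exprS -IHn -expiD -natr1 mulrDl mul1r addrC.
Qed.

Lemma expiDz (a : R) (m : int) : expi (a + 2 * pi * m%:~R) = expi a.
Proof. by rewrite /expi cosD2piz sinD2piz. Qed.

Definition in_dual N d (z : d.-tuple 'I_N) (k : d.-tuple int) : bool :=
  (N%:Z %| \sum_(j < d) tnth k j * (tnth z j : nat)%:Z)%Z.

(** Reducing a modulo N to b with 0 <= b < N, the real part of the left side is
1 - 2 sin^2(pi b/N), and the sine is positive unless b = 0. *)
Lemma expi_eq1 N (a : int) : (0 < N)%N ->
  (expi (2 * pi * (a%:~R / N%:R)) == 1 :> R[i]) = (N%:Z %| a)%Z.
Proof.
move=> N0.
have N0' : (N%:R : R) != 0 by rewrite pnatr_eq0 -lt0n.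
have aE : (a%:~R / N%:R : R) = (a %% N)%Z%:~R / N%:R + (a %/ N)%Z%:~R.
  rewrite {1}(divz_eq a N) rmorphD rmorphM /= addrC mulrDl.
  by rewrite -[N%:Z%:~R]/(N%:R) mulfK.
rewrite aE mulrDr expiDz.
have -> : (N%:Z %| a)%Z = ((a %% N)%Z == 0) by apply/dvdz_mod0P/eqP.
have [->|b0] := eqVneq (a %% N)%Z 0; first by rewrite mulr0z mul0r mulr0 expi0 eqxx.
have bge0 : (0 <= (a %% N)%Z) by apply: modz_ge0; lia.
have bltN : ((a %% N)%Z < N%:Z) by exact: ltz_pmod.
set b : R := (a %% N)%Z%:~R.
have b_gt0 : 0 < b by rewrite ltr0z lt0r b0 bge0.
have b_lt : b < N%:R by rewrite -[N%:R]/(N%:Z%:~R) ltr_int.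
pose t : R := pi * (b / N%:R).
have tE : 2 * pi * (b / N%:R) = t *+ 2 by rewrite -mulrA mulr_natl.
have sint : 0 < sin t.
  apply: sin_gt0_pi; rewrite mulr_gt0 ?pi_gt0 ?divr_gt0 ?ltr0n //=.
  by rewrite gtr_pMr ?pi_gt0 // ltr_pdivrMr ?mul1r // ltr0n.
rewrite tE; apply/negbTE/negP => /eqP /(congr1 (@complex.Re R)) /=.
rewrite cos_mulr2n cos2sin2 => h.
have : sin t ^+ 2 = 0 by lra.
by apply/eqP; rewrite sqrf_eq0 gt_eqF.
Qed.

(** Dropping the integer parts taken by [frac] does not change the
character. *)
Lemma fourier_char_lattice N d (z : d.-tuple 'I_N) (n : 'I_N) (k : d.-tuple int) :
  fourier_char k (lattice_points R z n) =
  expi (2 * pi * ((\sum_(j < d) tnth k j * (tnth z j : nat)%:Z)%:~R / N%:R)) ^+ n.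
Proof.
rewrite -expi_mulrn /fourier_char.
(* the sum of the integer parts removed by [frac] *)
pose m : int := - \sum_(j < d) tnth k j *
  Num.floor ((n * tnth z j)%:R / N%:R : R).
rewrite -[RHS](expiDz _ m); congr expi.
rewrite mulrCA -!mulrDr; congr (_ * _).
rewrite /dotp /m rmorphN rmorph_sum rmorph_sum /= mulr_suml mulr_sumr -sumrB.
apply: eq_bigr => j _; rewrite tnth_mktuple /frac !rmorphM /= mulrBr.
congr (_ - _); rewrite -[(tnth z j : nat)%:Z%:~R]/((tnth z j : nat)%:R); ring.
Qed.

(** A geometric sum over the powers of an N-th root of unity. *)
Lemma lattice_fourier_sum N d (z : d.-tuple 'I_N) (k : d.-tuple int) : (0 < N)%N ->
  \sum_(n < N) fourier_char k (lattice_points R z n) =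
  if in_dual z k then N%:R else 0.
Proof.
move=> N0; under eq_bigr do rewrite fourier_char_lattice.
set w := expi _.
have wN : w ^+ N = 1.
  rewrite -expi_mulrn mulrCA [X in 2 * pi * X]mulrCA mulfV ?mulr1.
    by rewrite -[X in expi X]add0r expiDz expi0.
  by rewrite pnatr_eq0 -lt0n.
rewrite /in_dual -(expi_eq1 _ N0) -/w.
have [->|w1] := eqVneq w 1.
  under eq_bigr do rewrite expr1n.
  by rewrite sumr_const card_ord.
have := subrX1 w N; rewrite wN subrr => /esym /eqP.
by rewrite mulf_eq0 subr_eq0 (negbTE w1) => /eqP.
Qed.

End lattice_characters.

(** * Fourier coefficients of functions in the unit ball *)

Section finite_subsums.
Variables (T : choiceType) (R : realType).

(** Fourier series are unconditional limits along finite sets of frequencies;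
this picks one finite set good enough for finitely many purposes at once. *)
Lemma common_finite_list (I : finType) (P : I -> seq T -> Prop) :
  (forall i s s', uniq s -> uniq s' -> {subset s <= s'} -> P i s -> P i s') ->
  (forall i, exists2 s, uniq s & P i s) ->
  exists2 s, uniq s & forall i, P i s.
Proof.
move=> mono ex; have {ex} ex i : {s | uniq s /\ P i s}.
  by apply: cid; have [s us Ps] := ex i; exists s.
pose s := undup (flatten [seq sval (ex i) | i <- enum I]).
exists s; first exact: undup_uniq.
move=> i; have [usi Psi] := proj2_sig (ex i).
apply: (mono _ _ _ usi _ _ Psi); first exact: undup_uniq.
move=> x xt; rewrite mem_undup; apply/flattenP; exists (sval (ex i)) => //.
by apply/mapP; exists i; rewrite ?mem_enum.
Qed.

Lemma ler_sum_subseq (s s' : seq T) (P : pred T) (F : T -> R) :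
  uniq s -> uniq s' -> {subset s <= s'} -> (forall x, 0 <= F x) ->
  \sum_(x <- s | P x) F x <= \sum_(x <- s' | P x) F x.
Proof.
move=> us us' ss F0; rewrite [leRHS](bigID (mem s)) /= -[leLHS]addr0.
apply: lerD; last by apply: sumr_ge0.
rewrite -big_filter -[leRHS]big_filter le_eqVlt; apply/orP; left; apply/eqP.
apply: perm_big; apply: uniq_perm; rewrite ?filter_uniq // => x.
rewrite !mem_filter; case: (boolP (x \in s)) => xs; rewrite ?andbF //.
by rewrite (ss _ xs) !andbT.
Qed.

Lemma cvg_partial_sum_seq (F : T -> R[i]) (l : R[i]) (e : R) :
  summability.partial_sum F @ summability.totally --> (l : R[i]^o) -> 0 < e ->
  exists2 s, uniq s & forall s', uniq s' -> {subset s <= s'} ->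
    cabs (l - \sum_(x <- s') F x) < e.
Proof.
move=> Fl e0.
have e0' : 0 < e%:C by rewrite ltcR.
have FF : Filter (@summability.totally T) by case: (@summability.totally_filter T).
have [A _ HA] := (@cvgrPdist_lt _ R[i]^o _ _ FF _ _).1 Fl _ e0'.
exists (enum_fset A); first exact: fset_uniq.
move=> s' us' ss'.
have /HA /= : [set B | fsubset A B] [fset x in s']%fset.
  by apply/fsubsetP => x xA; rewrite !inE; exact: ss'.
rewrite /summability.partial_sum -(big_seq_fsetE _ _ xpredT F) /=.
rewrite (perm_big s'); last first.
  by apply: uniq_perm => // x; rewrite !inE.
by rewrite normc_def -ltcR; case: (_ - _).
Qed.

End finite_subsums.

Section korobov_space.
Variables (R : realType) (d : nat) (alpha : R) (gamma : nat -> R).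
Hypothesis alpha_gt0 : 0 < alpha.
Hypothesis gamma01 : forall j, 0 <= gamma j <= 1.
Implicit Types (k : d.-tuple int) (f : d.-tuple R -> R).

(** The reciprocal of [korobov_weight]; a real number even where the weight is
infinite, in which case it vanishes. *)
Definition inv_weight k : R :=
  \prod_(j < d | tnth k j != 0) (gamma j / `|tnth k j|%:~R `^ alpha).

Lemma intr_norm_ge1 (m : int) : m != 0 -> 1 <= `|m|%:~R :> R.
Proof. by move=> m0; rewrite ler1z -gtz0_ge1 normr_gt0. Qed.

Lemma powR_intr_norm_ge1 (m : int) : m != 0 -> 1 <= `|m|%:~R `^ alpha :> R.
Proof.
move=> m0.
have : 1 `^ alpha <= `|m|%:~R `^ alpha :> R.
  apply: ge0_ler_powR; rewrite ?nnegrE ?intr_norm_ge1 //; first exact: ltW.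
by rewrite powR1.
Qed.

Lemma inv_weight_ge0 k : 0 <= inv_weight k.
Proof.
apply: prodr_ge0 => j _; apply: divr_ge0; last exact: powR_ge0.
by case/andP: (gamma01 j).
Qed.

Lemma korobov_weightE k : korobov_weight alpha gamma k =
  if inv_weight k == 0 then +oo%E else (inv_weight k)^-1%:E.
Proof.
rewrite /inv_weight /korobov_weight.
suff : let w := \big[*%E/1%E]_(j < d | tnth k j != 0)
    (if gamma j == 0 then +oo%E else (`|tnth k j|%:~R `^ alpha / gamma j)%:E) in
  let q := \prod_(j < d | tnth k j != 0) (gamma j / `|tnth k j|%:~R `^ alpha) in
  q = 0 /\ w = +oo%E \/ 0 < q /\ w = q^-1%:E.
  case=> -[h ->]; first by rewrite h eqxx.
  by rewrite gt_eqF.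
move=> /=; elim/big_rec2: _ => [|j q w k0 IH]; first by right; rewrite invr1.
have p1 := powR_intr_norm_ge1 k0.
have p0 : 0 < `|tnth k j|%:~R `^ alpha :> R by exact: lt_le_trans ltr01 p1.
have [g0|g0] := eqVneq (gamma j) 0.
  left; rewrite g0 !mul0r; split => //; case: IH => -[q0 ->].
    by rewrite mulyy.
  by rewrite gt0_mulye // lte_fin invr_gt0.
have gp : 0 < gamma j by rewrite lt0r g0; case/andP: (gamma01 j).
case: IH => -[q0 ->].
  by left; rewrite q0 mulr0; split => //; rewrite gt0_muley // lte_fin divr_gt0.
right; split; first by rewrite mulr_gt0 // divr_gt0.
by rewrite -EFinM invfM invf_div.
Qed.

Lemma korobov_fourier_coef0 f k : korobov alpha gamma f ->
  inv_weight k = 0 -> fourier_coef f k = 0.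
Proof. by move=> [_ _ h _] q0; apply: h; rewrite korobov_weightE q0 eqxx. Qed.

Lemma korobov_ball_sqsum f (s : seq (d.-tuple int)) :
  korobov_ball alpha gamma f -> uniq s ->
  \sum_(k <- s) (cabs (fourier_coef f k) ^+ 2 / inv_weight k ^+ 2) <= 1.
Proof.
move=> [fK n1] us; have [_ _ _ nf] := fK.
have nf0 : (0 <= korobov_sqnorm alpha gamma f)%E.
  apply: esum_ge0 => k _; rewrite mule_ge0 ?lee_fin ?sqr_ge0 //.
  rewrite korobov_weightE; case: ifP => _; first by rewrite mulyy.
  by rewrite -EFinM lee_fin mulr_ge0 // invr_ge0 inv_weight_ge0.
have le1 : (korobov_sqnorm alpha gamma f <= 1)%E.
  move: n1; rewrite /korobov_norm.
  rewrite -(@fineK _ (korobov_sqnorm alpha gamma f)) ?ge0_fin_numE // lee_fin.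
  rewrite fineK ?ge0_fin_numE // => n1.
  rewrite -(sqr_sqrtr (fine_ge0 nf0)) -(expr1n _ 2).
  by rewrite ler_pXn2r ?nnegrE ?sqrtr_ge0.
rewrite -lee_fin; apply: le_trans le1; apply: esum_ge.
exists [set` s]; first by split => //; exact: finite_seq.
rewrite -fsbig_seq // -sumEFin le_eqVlt; apply/orP; left; apply/eqP.
apply: eq_bigr => k _; rewrite korobov_weightE; case: eqP => [q0|/eqP q0].
  rewrite (korobov_fourier_coef0 fK) //.
  by rewrite ComplexField.Normc.normc0 expr0n /= !mul0r mul0e.
by rewrite -!EFinM -expr2 exprVn.
Qed.

End korobov_space.

(** * The error as a sum over the dual lattice *)

Definition nonzero d (k : d.-tuple int) : bool := [exists j, tnth k j != 0].

Lemma cabs_sum (R : realType) (I : Type) (s : seq I) (P : pred I) (F : I -> R[i]) :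
  cabs (\sum_(i <- s | P i) F i) <= \sum_(i <- s | P i) cabs (F i).
Proof.
elim/big_rec2: _ => [|i x y _ h]; first by rewrite ComplexField.Normc.normc0.
by rewrite (le_trans (le_normcD _ _)) // lerD2l.
Qed.

Lemma cabs_ge0 (R : realType) (x : R[i]) : 0 <= cabs x.
Proof. by case: x => a b; exact: sqrtr_ge0. Qed.

Lemma cabs_real (R : realType) (x : R) : cabs x%:C = `|x|.
Proof. by rewrite /= expr0n /= addr0 sqrtr_sqr. Qed.

Section lattice_error.
Variables (R : realType) (d : nat).
Implicit Types (k : d.-tuple int) (f : d.-tuple R -> R).

Lemma fourier_coef_zero f k : ~~ nonzero k -> fourier_coef f k = (cube_integral f)%:C.
Proof.
move=> /existsPn k0.
have dk (x : d.-tuple R) : dotp k x = 0.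
  rewrite /dotp big1 // => j _.
  by have := k0 j; rewrite negbK => /eqP ->; rewrite mul0r.
rewrite /fourier_coef /cube_cintegral.
have E (x : d.-tuple R) : (f x)%:C * expi (- (2 * pi * dotp k x)) = (f x)%:C.
  by rewrite dk mulr0 oppr0 expi0 mulr1.
under [X in X +i* _]eq_Rintegral do rewrite E /=.
under [X in _ +i* X]eq_Rintegral do rewrite E /=.
by rewrite Rintegral_cst ?mul0r //; exact: measurable_unit_cube.
Qed.

(** Average the Fourier series over the lattice points: only dual
frequencies survive, and the zero frequency contributes the integral. *)
Lemma integration_error_le_dual f N (z : d.-tuple 'I_N) (e : R) :
  abs_cvg_fourier f -> (0 < N)%N -> 0 < e ->
  exists2 s : seq (d.-tuple int), uniq s & forall s', uniq s' -> {subset s <= s'} ->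
    integration_error (lattice_points R z) f <=
    \sum_(k <- s' | nonzero k && in_dual z k) cabs (fourier_coef f k) + e.
Proof.
move=> [_ cf] N0 e0.
pose F (n : 'I_N) k := fourier_coef f k * fourier_char k (lattice_points R z n).
pose P (n : 'I_N) (s : seq (d.-tuple int)) :=
  forall s', uniq s' -> {subset s <= s'} ->
  cabs ((f (lattice_points R z n))%:C - \sum_(k <- s') F n k) < e.
have [||s us Ps] := @common_finite_list _ _ P.
- by move=> n s s' _ us' ss' Ps t ut s't; apply: Ps => // x /ss' /s't.
- move=> n.
  by have [s us Ps] := cvg_partial_sum_seq (cf (lattice_points R z n)) e0; exists s.
pose k0 : d.-tuple int := nseq_tuple d 0.
have k0z : ~~ nonzero k0.
  by apply/existsPn => j; rewrite tnth_nseq negbK.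
have zk0 k : ~~ nonzero k -> k = k0.
  move=> /existsPn kz; apply: eq_from_tnth => j; rewrite tnth_nseq.
  by have := kz j; rewrite negbK => /eqP.
exists (undup (k0 :: s)) => [|s' us' ss']; first exact: undup_uniq.
have k0s' : k0 \in s' by apply: ss'; rewrite mem_undup mem_head.
have {}Ps n : cabs ((f (lattice_points R z n))%:C - \sum_(k <- s') F n k) < e.
  by apply: Ps => // x xs; apply: ss'; rewrite mem_undup inE xs orbT.
set S := \sum_(k <- s' | nonzero k && in_dual z k) fourier_coef f k.
have sumF : \sum_(n < N) \sum_(k <- s') F n k =
    N%:R * ((cube_integral f)%:C + S).
  rewrite exchange_big /=.
  under eq_bigr do rewrite -mulr_sumr lattice_fourier_sum //.
  rewrite (bigID (@nonzero d)) /= addrC mulrDr; congr (_ + _).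
    rewrite -big_filter (perm_big [:: k0]) /=; last first.
      apply: uniq_perm; rewrite ?filter_uniq // => x; rewrite mem_filter inE.
      apply/andP/eqP => [[/zk0 //]|->]; by split.
    rewrite big_seq1 (fourier_coef_zero _ k0z) ifT; first exact: mulrC.
    rewrite /in_dual big1 ?dvdz0 // => j _; by rewrite tnth_nseq mul0r.
  rewrite /S mulr_sumr big_mkcondr /=; apply: eq_bigr => k _.
  by case: ifP => _; rewrite ?mulr0 // mulrC.
have N0' : (N%:R : R) != 0 by rewrite pnatr_eq0 -lt0n.
have N0c : (N%:R : R[i]) != 0 by rewrite pnatr_eq0 -lt0n.
have QE : (equal_weight_rule (lattice_points R z) f - cube_integral f)%:C =
   S + N%:R^-1 * \sum_(n < N) ((f (lattice_points R z n))%:C - \sum_(k <- s') F n k).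
  rewrite sumrB sumF /equal_weight_rule rmorphB rmorphM rmorph_sum /= mulrBr mulKf //.
  rewrite fmorphV rmorph_nat /=.
  by rewrite opprD addrCA [S + (_ - S)]addrCA subrr addr0.
rewrite /integration_error distrC -cabs_real QE.
apply: (le_trans (le_normcD _ _)); apply: lerD; first exact: cabs_sum.
rewrite ComplexField.Normc.normcM ComplexField.Normc.normcV.
have -> : cabs (N%:R : R[i]) = N%:R.
  by rewrite -(rmorph_nat (real_complex R)) cabs_real ger0_norm.
rewrite mulrC ler_pdivrMr ?ltr0n //.
apply: (le_trans (cabs_sum _ _ _)).
apply: (@le_trans _ _ (\sum_(n < N) e)); first by apply: ler_sum => n _; exact: ltW.
by rewrite sumr_const card_ord mulr_natr.
Qed.

End lattice_error.

Section cauchy_schwarz.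
Variables (R : realType) (d : nat) (alpha : R) (gamma : nat -> R).
Hypothesis alpha_gt0 : 0 < alpha.
Hypothesis gamma01 : forall j, 0 <= gamma j <= 1.
Implicit Types (k : d.-tuple int) (f : d.-tuple R -> R).
Local Notation q := (inv_weight alpha gamma).

(** Cauchy-Schwarz in the form a w <= (W/2) (a/q)^2 + (w q)^2 / (2W), which
needs only the bound 1 on the sum of the (a/q)^2. *)
Lemma korobov_ball_sum_le f (s : seq (d.-tuple int)) (P : pred (d.-tuple int))
    (w : d.-tuple int -> R) (W : R) :
  korobov_ball alpha gamma f -> uniq s -> 0 < W ->
  \sum_(k <- s | P k) (w k * q k) ^+ 2 <= W ^+ 2 ->
  \sum_(k <- s | P k) cabs (fourier_coef f k) * w k <= W.
Proof.
move=> fB us W0; rewrite -big_filter => ws; rewrite -[leLHS]big_filter.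
have {us} := korobov_ball_sqsum alpha_gt0 gamma01 fB (filter_uniq P us).
move: ws; set t := [seq k <- s | P k] => ws fs.
apply: (@le_trans _ _ (\sum_(k <- t) (W / 2 * (cabs (fourier_coef f k) ^+ 2 / q k ^+ 2)
    + (W * 2)^-1 * (w k * q k) ^+ 2))).
  apply: ler_sum => k _; have [q0|q0] := eqVneq (q k) 0.
    rewrite (korobov_fourier_coef0 alpha_gt0 gamma01 fB.1 q0).
    rewrite ComplexField.Normc.normc0 q0 !expr0n /= !mul0r !mulr0 expr0n /=.
    by rewrite mulr0 addr0.
  set a := cabs (fourier_coef f k); rewrite -subr_ge0.
  have -> : W / 2 * (a ^+ 2 / q k ^+ 2) + (W * 2)^-1 * (w k * q k) ^+ 2 - a * w k
     = (W * a / q k - w k * q k) ^+ 2 / (W * 2).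
    by field; rewrite q0 gt_eqF.
  by rewrite divr_ge0 ?sqr_ge0 // mulr_ge0 // ltW.
rewrite big_split /= -!mulr_sumr.
apply: (@le_trans _ _ (W / 2 * 1 + (W * 2)^-1 * W ^+ 2)).
  apply: lerD; apply: ler_wpM2l => //; first by rewrite divr_ge0 // ltW.
  by rewrite invr_ge0 mulr_ge0 // ltW.
rewrite le_eqVlt; apply/orP; left; apply/eqP; field; by rewrite gt_eqF.
Qed.

End cauchy_schwarz.

(** * Fourier coefficients of a cosine wave *)

Lemma big_support_seq (V : nmodType) (T : eqType) (s s' : seq T) (F : T -> V) :
  uniq s -> uniq s' -> {subset s <= s'} -> (forall x, x \notin s -> F x = 0) ->
  \sum_(x <- s') F x = \sum_(x <- s) F x.
Proof.
move=> us us' ss F0; rewrite (bigID (mem s)) /= [X in _ + X]big1 ?addr0; last first.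
  by move=> x; exact: F0.
rewrite -big_filter; apply: perm_big; apply: uniq_perm; rewrite ?filter_uniq // => x.
by rewrite mem_filter; apply/andP/idP => [[]//|xs]; split => //; exact: ss.
Qed.

Lemma esum_support_seq (R : realType) (T : choiceType) (s : seq T) (a : T -> \bar R) :
  uniq s -> (forall x, 0 <= a x)%E -> (forall x, x \notin s -> a x = 0%E) ->
  \esum_(x in [set: T]) a x = (\sum_(x <- s) a x)%E.
Proof.
move=> us a0 as0.
transitivity (\esum_(x in [set` s]) a x).
  rewrite [RHS]esum_mkcond; apply: eq_esum => x _.
  by case: ifPn => // xs; rewrite as0 //; apply: contra xs; rewrite inE.
by rewrite esum_fset ?finite_seq //= -fsbig_seq.
Qed.

Section frequencies.
Variables (R : realType) (d : nat).
Implicit Types (k l : d.-tuple int) (x : d.-tuple R).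

Definition freq_add k l : d.-tuple int := [tuple tnth k j + tnth l j | j < d].
Definition freq_opp k : d.-tuple int := [tuple - tnth k j | j < d].

Lemma dotp_add k l x : dotp (freq_add k l) x = dotp k x + dotp l x.
Proof.
rewrite /dotp -big_split /=; apply: eq_bigr => j _.
by rewrite tnth_mktuple rmorphD mulrDl.
Qed.

Lemma dotp_opp k x : dotp (freq_opp k) x = - dotp k x.
Proof.
rewrite /dotp -sumrN; apply: eq_bigr => j _.
by rewrite tnth_mktuple rmorphN mulNr.
Qed.

Lemma freq_add_opp_eq0 k l :
  [forall j, tnth (freq_add k (freq_opp l)) j == 0] = (l == k).
Proof.
apply/forallP/eqP => [h|-> j]; last by rewrite !tnth_mktuple subrr.
by apply: eq_from_tnth => j; have := h j; rewrite !tnth_mktuple subr_eq0 => /eqP.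
Qed.

Lemma freq_oppK : involutive freq_opp.
Proof. by move=> k; apply: eq_from_tnth => j; rewrite !tnth_mktuple opprK. Qed.

Lemma freq_add_eq0 k l : [forall j, tnth (freq_add k l) j == 0] = (l == freq_opp k).
Proof. by rewrite -{1}[l]freq_oppK freq_add_opp_eq0 -[in RHS](inv_eq freq_oppK). Qed.

Lemma freq_opp_neq k : nonzero k -> freq_opp k != k.
Proof.
move=> /existsP[j kj]; apply/eqP => /(congr1 (fun t => tnth t j)).
rewrite /= tnth_mktuple; move: (tnth k j) kj => m; lia.
Qed.

Lemma fourier_char_dotp k x :
  fourier_char k x + fourier_char (freq_opp k) x = (2 * cos (2 * pi * dotp k x))%:C.
Proof.
rewrite /fourier_char dotp_opp mulrN /expi cosN sinN.
apply/eqP; rewrite eq_complex /=; apply/andP; split; apply/eqP; first by ring.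
by rewrite subrr.
Qed.

Lemma integrable_cos_dotp k (t a : R) :
  (lebesgue_tuple R d).-integrable (@unit_cube R d)
    (EFin \o (fun x => a * cos (2 * pi * dotp k x + t))).
Proof.
apply: measurable_bounded_integrable.
- exact: measurable_unit_cube.
- by rewrite [X in (X < _)%E]lebesgue_tuple_unit_cube ltry.
- apply: measurable_funTS; apply: measurable_funM; first exact: measurable_cst.
  exact: measurable_cos_dotp.
- exists `|a|; split; first exact: num_real.
  move=> y ay u _ /=; rewrite normrM (le_trans _ (ltW ay)) // ler_piMr //.
  exact: cos_max.
Qed.

Lemma cube_integral_cosD k l (a b t u : R) :
  cube_integral (fun x => a * cos (2 * pi * dotp k x + t)
                        + b * cos (2 * pi * dotp l x + u)) =
  a * (if [forall j, tnth k j == 0] then cos t else 0) +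
  b * (if [forall j, tnth l j == 0] then cos u else 0).
Proof.
rewrite -!cube_integral_cos /cube_integral.
rewrite RintegralD; [|exact: measurable_unit_cube|exact: integrable_cos_dotp..].
have i k' t' := integrable_cos_dotp k' t' 1.
congr (_ + _); rewrite RintegralZl //; try exact: measurable_unit_cube.
  by have := i k t; congr (_.-integrable _ _); apply/funext => x /=; rewrite mul1r.
by have := i l u; congr (_.-integrable _ _); apply/funext => x /=; rewrite mul1r.
Qed.

(** Product formulas turn the integrands into sums of cosines of frequencies
k - l and k + l; in the imaginary part all phases are -pi/2, whose cosine is 0. *)
Lemma fourier_coef_cos k l (q : R) : nonzero k ->
  fourier_coef (fun x => q * cos (2 * pi * dotp k x)) l =
  (if l \in [:: k; freq_opp k] then q / 2 else 0)%:C.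
Proof.
move=> k0.
have cpi : cos (- (pi / 2)) = 0 :> R by rewrite cosN cos_pihalf.
congr (_ +i* _).
  transitivity (cube_integral (fun x =>
      q / 2 * cos (2 * pi * dotp (freq_add k (freq_opp l)) x + 0) +
      q / 2 * cos (2 * pi * dotp (freq_add k l) x + 0))).
    congr cube_integral; apply/funext => x /=; rewrite !dotp_add dotp_opp.
    move: (2 * pi) => c.
    by rewrite mulrBr mulrDr !addr0 cosN sinN mul0r subr0 cosB cosD; field.
  rewrite cube_integral_cosD freq_add_opp_eq0 freq_add_eq0 cos0 !inE.
  have := freq_opp_neq k0; case: (eqVneq l k) => [->|lk] /=.
    by rewrite eq_sym => /negbTE ->; rewrite mulr1 mulr0 addr0.
  by move=> _; case: (l == freq_opp k); rewrite ?mulr1 !mulr0 ?addr0 ?add0r.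
transitivity (cube_integral (fun x =>
      q / 2 * cos (2 * pi * dotp (freq_add k (freq_opp l)) x + - (pi / 2)) +
      - (q / 2) * cos (2 * pi * dotp (freq_add k l) x + - (pi / 2)))).
  congr cube_integral; apply/funext => x /=; rewrite !dotp_add dotp_opp.
  rewrite !cosBpihalf; move: (2 * pi) => c.
  by rewrite mulrBr mulrDr cosN sinN mul0r addr0 sinB sinD; field.

by rewrite cube_integral_cosD cpi !if_same !mulr0 addr0.
Qed.

End frequencies.

(** * Worst-case error and short dual vectors *)

Section test_function.
Variables (R : realType) (d : nat) (alpha : R) (gamma : nat -> R).
Hypothesis alpha_gt0 : 0 < alpha.
Hypothesis gamma01 : forall j, 0 <= gamma j <= 1.
Implicit Types (k l : d.-tuple int) (f : d.-tuple R -> R).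
Local Notation q := (inv_weight alpha gamma).

Lemma inv_weight_opp k : q (freq_opp k) = q k.
Proof.
rewrite /inv_weight; apply: eq_big => [j|j _]; rewrite tnth_mktuple ?oppr_eq0 //.
by rewrite normrN.
Qed.

(** The amplitude is chosen so that the squared norm is
2 (q/2)^2 / q^2 = 1/2. *)
Definition cos_wave k : d.-tuple R -> R := fun x => q k * cos (2 * pi * dotp k x).

Lemma uniq_freq_pair k : nonzero k -> uniq [:: k; freq_opp k].
Proof. by move=> /freq_opp_neq h; rewrite /= inE eq_sym h. Qed.

Lemma cos_wave_periodic k : one_periodic (cos_wave k).
Proof.
move=> x y /choice[m ym]; rewrite /cos_wave.
have -> : dotp k y = dotp k x + (\sum_(j < d) tnth k j * m j)%:~R.
  rewrite /dotp rmorph_sum -big_split /=; apply: eq_bigr => j _.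
  by rewrite ym mulrDr rmorphM.
by rewrite mulrDr cosD2piz.
Qed.

Lemma cos_wave_abs_cvg k : nonzero k -> abs_cvg_fourier (cos_wave k).
Proof.
move=> k0; have us := uniq_freq_pair k0.
split.
  rewrite /summable (@esum_support_seq _ _ [:: k; freq_opp k]) //.
    by rewrite big_cons big_seq1 -EFinD ltry.
  move=> l /negbTE lk; rewrite fourier_coef_cos // lk.
  by rewrite ComplexField.Normc.normc0 /= normr0.
move=> x.
have FF : Filter (@summability.totally (d.-tuple int)).
  by case: (@summability.totally_filter (d.-tuple int)).
apply: (@cvg_near_cst _ R[i]^o _ _ _ FF).
exists [fset k; freq_opp k]%fset => // B /= /fsubsetP kB.
rewrite /summability.partial_sum -(big_seq_fsetE _ _ xpredT
  (fun l => fourier_coef (cos_wave k) l * fourier_char l x)) /=.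
rewrite (@big_support_seq _ _ [:: k; freq_opp k]) ?fset_uniq //; last 2 first.
- by move=> l; rewrite !inE => lk; apply: kB; rewrite !inE.
- by move=> l /negbTE lk; rewrite fourier_coef_cos // lk mul0r.
rewrite big_cons big_seq1 !fourier_coef_cos // !inE !eqxx orbT /=.
rewrite -mulrDr fourier_char_dotp /cos_wave -rmorphM /=.
by congr (_%:C); field.
Qed.

Lemma cos_wave_sqnorm k : nonzero k -> q k != 0 ->
  korobov_sqnorm alpha gamma (cos_wave k) = (2^-1)%:E.
Proof.
move=> k0 q0; have us := uniq_freq_pair k0.
rewrite /korobov_sqnorm (@esum_support_seq _ _ [:: k; freq_opp k]) //; last 2 first.
- move=> l; rewrite mule_ge0 ?lee_fin ?sqr_ge0 // korobov_weightE //.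
  case: ifP => _; first by rewrite mulyy.
  by rewrite -EFinM lee_fin mulr_ge0 // invr_ge0 inv_weight_ge0.
- move=> l /negbTE lk; rewrite fourier_coef_cos // lk.
  by rewrite ComplexField.Normc.normc0 expr0n mul0e.
rewrite big_cons big_seq1 !korobov_weightE // inv_weight_opp (negbTE q0).
rewrite !fourier_coef_cos // !inE !eqxx orbT /= !expr0n /= !addr0.
rewrite !sqr_sqrtr ?sqr_ge0 // -!EFinM -EFinD; congr (_%:E).
by field.
Qed.

Lemma cos_wave_ball k : nonzero k -> q k != 0 -> korobov_ball alpha gamma (cos_wave k).
Proof.
move=> k0 q0; split; last first.
  rewrite /korobov_norm cos_wave_sqnorm //= -[leRHS]sqrtr1 ler_wsqrtr //.
  by rewrite invf_le1 // ler1n.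
split; [exact: cos_wave_periodic|exact: cos_wave_abs_cvg| |].
  move=> l; rewrite korobov_weightE //; case: ifP => // /eqP ql _.
  rewrite fourier_coef_cos // ifF //; apply/negbTE; rewrite !inE negb_or.
  apply/andP; split; apply/eqP => lk; move: q0; rewrite -ql lk ?inv_weight_opp eqxx //.
by rewrite cos_wave_sqnorm // ltry.
Qed.

(** The integral vanishes, while at every lattice point the phase of a dual
frequency is a multiple of 2 pi. *)
Lemma cos_wave_error N (z : d.-tuple 'I_N) k : nonzero k -> (0 < N)%N -> in_dual z k ->
  integration_error (lattice_points R z) (cos_wave k) = q k.
Proof.
move=> k0 N0 zk; rewrite /integration_error.
have -> : cube_integral (cos_wave k) = 0.
  have := @cube_integral_cosD R d k k (q k) 0 0 0.
  rewrite ifF; last first.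
    apply/negbTE; move: k0; rewrite /nonzero; apply: contraL => /forallP h.
    by apply/existsPn => j; rewrite negbK.
  rewrite !mulr0 addr0 => <-; congr cube_integral; apply/funext => x.
  by rewrite /cos_wave addr0 mul0r addr0.
rewrite sub0r normrN /equal_weight_rule -mulr_sumr.
have N0' : (N%:R : R) != 0 by rewrite pnatr_eq0 -lt0n.
have -> : \sum_(n < N) cos (2 * pi * dotp k (lattice_points R z n)) = N%:R.
  have /(congr1 (@complex.Re R)) := @lattice_fourier_sum R N d z k N0.
  by rewrite zk raddf_sum -(rmorph_nat (real_complex R)).
by rewrite mulrCA mulVf // mulr1 ger0_norm // inv_weight_ge0.
Qed.

(** A rule with small worst-case error has no dual vector of large inverse
weight: the cosine wave would be integrated badly. *)
Lemma inv_weight_le_wce N (z : d.-tuple 'I_N) k :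
  nonzero k -> q k != 0 -> (0 < N)%N -> in_dual z k ->
  ((q k)%:E <= wce alpha gamma (lattice_points R z))%E.
Proof.
move=> k0 q0 N0 zk; apply: ereal_sup_ubound.
by exists (cos_wave k); [exact: cos_wave_ball|rewrite cos_wave_error].
Qed.

(** Contrapositive of the upper bound for the error by Cauchy-Schwarz with
unit weights. *)
Lemma lt_wce_dual_sum N (z : d.-tuple 'I_N) (B : R) :
  (0 < N)%N -> 0 < B -> (B%:E < wce alpha gamma (lattice_points R z))%E ->
  exists2 s : seq (d.-tuple int), uniq s &
    B ^+ 2 < \sum_(k <- s | nonzero k && in_dual z k) q k ^+ 2.
Proof.
move=> N0 B0 /ereal_sup_gt[_ [f fB <-]]; rewrite lte_fin => Bf.
have e0 : 0 < (integration_error (lattice_points R z) f - B) / 2.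
  by rewrite divr_gt0 // subr_gt0.
have [_ af _ _] := fB.1.
have [s us hs] := integration_error_le_dual z af N0 e0.
exists s => //; rewrite ltNge; apply/negP => sB.
have := @korobov_ball_sum_le R d alpha gamma alpha_gt0 gamma01 f s
  (fun k => nonzero k && in_dual z k) (fun=> 1) B fB us B0.
under eq_bigr do rewrite mul1r.
move=> /(_ sB); under eq_bigr do rewrite mulr1.
by move=> h; have := hs s us (fun _ => id); lra.
Qed.
End test_function.

(** * Sums of powers of the inverse weights *)

Section zeta_sums.
Variable R : realType.

Local Notation zsum s := (series (fun n => n.+1%:R `^ (- s) : R)).

(** Pair the terms 2i and 2i+1 and bound the second by the first. *)
Lemma zsum_double (s : R) m : 0 <= s ->
  zsum s m.*2.+1 <= 1 + 2 `^ (1 - s) * zsum s m.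
Proof.
move=> s0; elim: m => [|m IHm].
  by rewrite /series /= big_nat1 big_geq // mulr0 addr0 powR1.
rewrite doubleS (seriesSr _ m.*2.+2) (seriesSr _ m.*2.+1) (seriesSr _ m).
move: IHm; set S := zsum s m.*2.+1; set T := zsum s m => IHm.
have h1 : m.*2.+1.+1%:R `^ (- s) = 2 `^ (- s) * m.+1%:R `^ (- s) :> R.
  by rewrite -doubleS -muln2 mulnC natrM powRM // ler0n.
have h2 : m.*2.+2.+1%:R `^ (- s) <= m.*2.+1.+1%:R `^ (- s) :> R.
  rewrite !powRN lef_pV2 ?posrE ?powR_gt0 ?ltr0n //.
  by apply: ge0_ler_powR; rewrite ?nnegrE ?ler_nat.
have h3 : 2 `^ (1 - s) = 2 * 2 `^ (- s) :> R.
  by rewrite powRD ?powRr1 // pnatr_eq0 implybT.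
rewrite mulrDr; apply: (@le_trans _ _ (S + 2 * m.*2.+1.+1%:R `^ (- s))); first by lra.
by rewrite h3 in IHm *; rewrite h1; lra.
Qed.

(** By the doubling inequality S <= 1 + 2^(1-s) S, with 2^(1-s) < 1. *)
Lemma zsum_bound (s : R) m : 1 < s -> zsum s m <= (1 - 2 `^ (1 - s))^-1.
Proof.
move=> s1; have s0 : 0 <= s by lra.
have c1 : 2 `^ (1 - s) < 1 :> R.
  rewrite /powR pnatr_eq0 /=; have : expR ((1 - s) * ln 2) < expR 0 :> R.
    by rewrite ltr_expR nmulr_rlt0 ?subr_lt0 // ln_gt0 // ltr1n.
  by rewrite expR0.
have := zsum_double m s0.
have : zsum s m <= zsum s m.*2.+1.
  rewrite /series /= [leRHS](big_cat_nat _ _ (n := m)) //=; last by lia.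
  by rewrite lerDl; apply: sumr_ge0 => i _; exact: powR_ge0.
move=> h1 h2; rewrite -[leRHS]mul1r ler_pdivlMr ?subr_gt0 //; lra.
Qed.

Lemma zsum_le_zeta (s : R) m : 1 < s -> zsum s m <= zeta s.
Proof.
move=> s1; apply: nondecreasing_cvgn_le.
  by apply: nondecreasing_series => n _ _; exact: powR_ge0.
apply: nondecreasing_is_cvgn.
  by apply: nondecreasing_series => n _ _; exact: powR_ge0.
by exists (1 - 2 `^ (1 - s))^-1 => _ [n _ <-]; exact: zsum_bound.
Qed.

Lemma zeta_ge0 (s : R) : 1 < s -> 0 <= zeta s.
Proof. by move=> s1; have := zsum_le_zeta 0 s1; rewrite /series /= big_geq. Qed.

End zeta_sums.

Lemma ler_sum_undup (R : realType) (T : eqType) (s : seq T) (F : T -> R) :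
  (forall x, 0 <= F x) -> \sum_(x <- undup s) F x <= \sum_(x <- s) F x.
Proof.
move=> F0; elim: s => [|x s IHs] /=; first by rewrite big_nil.
rewrite big_cons; case: ifP => _; last by rewrite big_cons lerD2l.
by rewrite (le_trans IHs) // lerDr.
Qed.

Section weight_sums.
Variables (R : realType) (d : nat) (alpha : R) (gamma : nat -> R).
Hypothesis alpha_gt0 : 0 < alpha.
Hypothesis gamma01 : forall j, 0 <= gamma j <= 1.
Implicit Types (k : d.-tuple int).
Local Notation q := (inv_weight alpha gamma).

Definition zeta_prod (s : R) : R :=
  \prod_(j < d) (1 + 2 * gamma j `^ s * zeta (alpha * s)).

(** The factor of q^s contributed by one coordinate. *)
Definition coord_weight (s : R) (j : nat) (m : int) : R :=
  if m == 0 then 1 else gamma j `^ s * `|m|%:~R `^ (- (alpha * s)).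

Lemma pow_weight1_ge0 s j m : 0 <= coord_weight s j m.
Proof. by rewrite /coord_weight; case: ifP => _ //; rewrite mulr_ge0 ?powR_ge0. Qed.

Lemma inv_weight_powR s k : q k `^ s = \prod_(j < d) coord_weight s j (tnth k j).
Proof.
rewrite /inv_weight; transitivity (\prod_(j < d | tnth k j != 0)
    (gamma j / `|tnth k j|%:~R `^ alpha) `^ s).
  have f0 (j : 'I_d) : 0 <= gamma j / `|tnth k j|%:~R `^ alpha.
    by apply: divr_ge0; [case/andP: (gamma01 j)|exact: powR_ge0].
  suff [] : 0 <= \prod_(j < d | tnth k j != 0) (gamma j / `|tnth k j|%:~R `^ alpha) /\
    (\prod_(j < d | tnth k j != 0) (gamma j / `|tnth k j|%:~R `^ alpha)) `^ s =
    \prod_(j < d | tnth k j != 0) (gamma j / `|tnth k j|%:~R `^ alpha) `^ s by [].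
  elim/big_rec2: _ => [|j x y _ [y0 <-]]; first by rewrite powR1.
  by rewrite mulr_ge0 // powRM.
rewrite [LHS]big_mkcond; apply: eq_bigr => j _; rewrite /coord_weight.
case: eqVneq => //= kj; have [g0 _] := andP (gamma01 j).
rewrite powRM ?invr_ge0 ?powR_ge0 // -powR_inv1 ?powR_ge0 //.
by rewrite -!powRrM mulN1r mulrN.
Qed.

(** Any finite list of frequencies lies in a box, over which the sum of a
product factors into sums over single coordinates. *)
Lemma sum_inv_weight_le (s : R) (l : seq (d.-tuple int)) : 1 < alpha * s ->
  uniq l -> \sum_(k <- l) q k `^ s <= zeta_prod s.
Proof.
move=> as1 ul.
pose K := \max_(k <- l) \max_(j < d) `|tnth k j|%N.
have KP k j : k \in l -> (`|tnth k j|%N <= K)%N.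
  move=> kl; apply: (leq_trans (leq_bigmax (F := fun j => `|tnth k j|%N) j)).
  exact: (@leq_bigmax_seq _ l xpredT (fun k => \max_(j < d) `|tnth k j|%N)).
(* the integers of [-K, K] as zero, positive and negative ones *)
pose I : finType := ('I_1 + ('I_K + 'I_K))%type.
pose v (i : I) : int := match i with
  | inl _ => 0 | inr (inl i) => i.+1%:Z | inr (inr i) => - i.+1%:Z end.
have vP (m : int) : (`|m| <= K)%N -> exists i, v i = m.
  case: m => [[|m]|m] /= mK; first by exists (inl ord0).
    by exists (inr (inl (Ordinal mK))).
  by exists (inr (inr (Ordinal mK))); rewrite /= NegzE.
pose g (f : {ffun 'I_d -> I}) : d.-tuple int := [tuple v (f j) | j < d].
have gP k : k \in l -> exists f, g f = k.
  move=> kl; have /choice[f fk] j : exists i, v i = tnth k j by apply: vP; exact: KP.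
  by exists [ffun j => f j]; apply: eq_from_tnth => j; rewrite tnth_mktuple ffunE.
apply: (@le_trans _ _ (\sum_(k <- undup (codom g)) q k `^ s)).
  apply: ler_sum_subseq => //; rewrite ?undup_uniq //.
    2: by move=> x; exact: powR_ge0.
  by move=> k /gP[f <-]; rewrite mem_undup codom_f.
apply: (@le_trans _ _ (\sum_f q (g f) `^ s)).
  have <- : \sum_(k <- codom g) q k `^ s = \sum_f q (g f) `^ s.
    by rewrite big_map big_enum.
  by apply: ler_sum_undup => k; exact: powR_ge0.
under eq_bigr => f _.
  rewrite inv_weight_powR; under eq_bigr do rewrite tnth_mktuple.
  over.
rewrite -(bigA_distr_bigA (fun (j : 'I_d) i => coord_weight s j (v i))) /=.
apply: ler_prod => j _; rewrite sumr_ge0 => [/=|i _]; last exact: pow_weight1_ge0.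
have E1 (i : nat) :
    coord_weight s j i.+1%:Z = gamma j `^ s * i.+1%:R `^ (- (alpha * s)).
  by [].
have E2 (i : nat) :
    coord_weight s j (- i.+1%:Z) = gamma j `^ s * i.+1%:R `^ (- (alpha * s)).
  by rewrite /coord_weight oppr_eq0 normrN.
rewrite !big_sumType /= big_ord1 {1}/coord_weight eqxx lerD2l.
rewrite (eq_bigr _ (fun (i : 'I_K) _ => E1 i)) (eq_bigr _ (fun (i : 'I_K) _ => E2 i)).
rewrite -!mulr_sumr.
have hz : \sum_(i < K) i.+1%:R `^ (- (alpha * s)) <= zeta (alpha * s).
  by apply: le_trans (zsum_le_zeta K as1); rewrite /series /= big_mkord.
have := ler_wpM2l (powR_ge0 (gamma j) s) hz.
by lra.
Qed.

Lemma zeta_prod_ge1 (s : R) : 1 < alpha * s -> 1 <= zeta_prod s.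
Proof.
move=> as1; rewrite /zeta_prod; elim/big_rec: _ => // j x _ x1.
have h : 1 <= 1 + 2 * gamma j `^ s * zeta (alpha * s).
  by rewrite lerDl !mulr_ge0 ?powR_ge0 // zeta_ge0.
by rewrite (le_trans h) // ler_peMr // (le_trans ler01).
Qed.

End weight_sums.

(** * Counting draws and dual generators *)

Section independent_draws.
Variable R : realType.

(** Independence of the coordinates of a uniform tuple, in the form of the
distributive law. *)
Lemma sum_tuple_prod (T : finType) (r : nat) (A : {set T}) (F : 'I_r -> T -> R) :
  \sum_(t : r.-tuple T | [forall i, tnth t i \in A]) \prod_(i < r) F i (tnth t i) =
  \prod_(i < r) \sum_(z in A) F i z.
Proof.
rewrite (bigA_distr_big (mem A)) /=.
pose g (f : {ffun 'I_r -> T}) : r.-tuple T := [tuple f i | i < r].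
have gK : cancel g (fun t => [ffun i => tnth t i]).
  by move=> f; apply/ffunP => i; rewrite ffunE tnth_mktuple.
have gK' : cancel (fun t : r.-tuple T => [ffun i => tnth t i]) g.
  by move=> t; apply: eq_from_tnth => i; rewrite tnth_mktuple ffunE.
rewrite (reindex g) /=; last first.
  by exists (fun t => [ffun i => tnth t i]) => ? _; [exact: gK|exact: gK'].
apply: eq_big => [f|f _]; last by apply: eq_bigr => i _; rewrite tnth_mktuple.
apply/forallP/ffun_onP => h i; first by have := h i; rewrite tnth_mktuple.
by rewrite tnth_mktuple; exact: h.
Qed.

Variables (d r N : nat).
Local Notation gen := (generators d N).

Lemma card_draws_expn : #|draws d r N|%:R = #|gen|%:R ^+ r :> R.
Proof.
have := @sum_tuple_prod _ r gen (fun _ _ => 1).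
rewrite [X in _ = X -> _](_ : _ = #|gen|%:R ^+ r); last first.
  rewrite (eq_bigr (fun=> #|gen|%:R)) => [|i _]; last by rewrite sumr_const.
  by rewrite prodr_const card_ord.
move=> <-; rewrite (eq_bigr (fun=> 1)) => [|t _]; last by rewrite prodr_const expr1n.
by rewrite sumr_const; congr (_%:R); apply: eq_card => t; rewrite !inE.
Qed.

Lemma uniform_mean_coordinate (i : 'I_r) (F : d.-tuple 'I_N -> R) :
  (0 < #|gen|)%N ->
  uniform_mean (draws d r N) (fun zs => F (tnth zs i)) = uniform_mean gen F.
Proof.
move=> g0; rewrite /uniform_mean card_draws_expn.
have := @sum_tuple_prod _ r gen (fun j z => if j == i then F z else 1).
rewrite (bigD1 i) //= eqxx.
rewrite [X in _ = _ * X](eq_bigr (fun=> #|gen|%:R)); last first.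
  by move=> j /negbTE ji; under eq_bigr do rewrite ji; rewrite sumr_const.
rewrite prodr_const cardC1 card_ord.
have -> : \sum_(zs in draws d r N) F (tnth zs i) =
   \sum_(t : r.-tuple (d.-tuple 'I_N) | [forall i, tnth t i \in gen]) \prod_(i0 < r)
           (if i0 == i then F (tnth t i0) else 1).
  apply: eq_big => [t|t _]; first by rewrite inE.
  by rewrite (bigD1 i) //= eqxx big1 ?mulr1 // => j /negbTE ->.
move=> ->; have [m rE] : exists m, r = m.+1 by exists r.-1; case: (r) i => [[]|].
rewrite rE /= exprS invfM -mulrA; congr (_ * _); rewrite mulrCA mulVf ?mulr1 //.
by rewrite expf_neq0 // pnatr_eq0 -lt0n.
Qed.

Lemma card_draws_all (A : {set d.-tuple 'I_N}) : A \subset gen ->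
  #|[set zs in draws d r N | [forall i, tnth zs i \in A]]|%:R = #|A|%:R ^+ r :> R.
Proof.
move=> /fintype.subsetP Ag; have := @sum_tuple_prod _ r A (fun _ _ => 1).
rewrite [X in _ = X -> _](_ : _ = #|A|%:R ^+ r); last first.
  rewrite (eq_bigr (fun=> #|A|%:R)) => [|i _]; last by rewrite sumr_const.
  by rewrite prodr_const card_ord.
move=> <-; rewrite (eq_bigr (fun=> 1)) => [|t _]; last by rewrite prodr_const expr1n.
rewrite sumr_const; congr (_%:R); apply: eq_card => t; rewrite !inE.
rewrite [RHS]unfold_in /=.
apply/andP/idP => [[]//|/forallP h]; split; last exact/forallP.
by apply/forallP => i; exact: Ag.
Qed.

End independent_draws.

Section dual_counting.
Variables (d N : nat).
Hypothesis Np : prime N.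
Local Notation gen := (generators d N).

Lemma card_generators_gt0 : (0 < #|gen|)%N.
Proof.
have N1 := prime_gt1 Np.
apply/card_gt0P; exists [tuple of nseq d (Ordinal N1)].
by rewrite inE; apply/forallP => j; rewrite tnth_nseq.
Qed.

(** Fix a coordinate j with N not dividing k_j.  Overwriting the j-th entry of
a dual generator by any of the N - 1 admissible values is injective, since the
other entries and duality determine the old j-th entry modulo N. *)
Lemma card_dual_le (k : d.-tuple int) : ~~ [forall j, (N%:Z %| tnth k j)%Z] ->
  (#|[set z in gen | in_dual z k]| * N.-1 <= #|gen|)%N.
Proof.
move=> /forallPn[j kj].
set D := [set z in gen | in_dual z k].
pose U : {set 'I_N} := finset (fun t : 'I_N => 0 < t)%N.
have -> : N.-1 = #|U|.
  rewrite {}/U; case: (N) Np => // n _ /=.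
  rewrite (_ : finset _ = finset.setC (finset.set1 ord0)) ?cardsC1 ?card_ord //.
  by apply/finset.setP => t; rewrite !inE -val_eqE /= lt0n.
rewrite -cardsX.
pose h (p : d.-tuple 'I_N * 'I_N) : d.-tuple 'I_N :=
  [tuple if i == j then p.2 else tnth p.1 i | i < d].
have inj : {in finset.setX D U &, injective h}.
  move=> [z t] [z' t']; rewrite !inE /=.
  move=> /andP[/andP[_ dz] _] /andP[/andP[_ dz'] _] hh.
  have E i := congr1 (fun v => tnth v i) hh.
  have -> : t = t' by have := E j; rewrite !tnth_mktuple eqxx.
  have zz i : i != j -> tnth z i = tnth z' i.
    by move=> /negbTE ij; have := E i; rewrite !tnth_mktuple ij.
  suff zj : tnth z j = tnth z' j.
    by congr (_, _); apply: eq_from_tnth => i; have [->|/zz] := eqVneq i j.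
  have : (N%:Z %| tnth k j * ((tnth z j : nat)%:Z - (tnth z' j : nat)%:Z))%Z.
    have -> : tnth k j * ((tnth z j : nat)%:Z - (tnth z' j : nat)%:Z) =
       \sum_(i < d) tnth k i * (tnth z i : nat)%:Z -
       \sum_(i < d) tnth k i * (tnth z' i : nat)%:Z.
      rewrite (bigD1 j) //= [X in _ = _ - X](bigD1 j) //=.
      rewrite [X in _ = _ - (_ + X)](eq_bigr
        (fun i => tnth k i * (tnth z i : nat)%:Z)); last first.
        by move=> i ij; rewrite zz.
      by rewrite mulrBr opprD addrACA subrr addr0.
    by apply: rpredB.
  rewrite Gauss_dvdzr; last first.
    rewrite /coprimez /gcdz /= eqz_nat; apply/eqP/eqP.
    by rewrite -/(coprime N `|tnth k j|) prime_coprime.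
  have := ltn_ord (tnth z j); have := ltn_ord (tnth z' j).
  rewrite dvdzE /= => b b' dv; apply/val_inj => /=.
  have [//|ne] := eqVneq (tnth z j : nat) (tnth z' j).
  have := dvdn_leq _ dv; lia.
have /= <- := card_in_imset inj; apply: subset_leq_card.
apply/fintype.subsetP => y /imsetP[[z t] zt ->]; move: zt.
rewrite !inE /= => /andP[/andP[/forallP zg _] t0].
by apply/forallP => i; rewrite tnth_mktuple; case: ifP.
Qed.

End dual_counting.

(** * Few generators are bad *)

(** Subadditivity: u = u^(1-p) u^p <= (x+y)^(1-p) u^p for u = x and u = y. *)
Lemma powRD_le (R : realType) (p x y : R) : 0 < p -> p <= 1 -> 0 <= x -> 0 <= y ->
  (x + y) `^ p <= x `^ p + y `^ p.
Proof.
move=> p0 p1 x0 y0; have [xy0|xyn] := eqVneq (x + y) 0.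
  by rewrite xy0 powR0 ?gt_eqF // addr_ge0 ?powR_ge0.
have xyp : 0 < x + y by rewrite lt0r xyn addr_ge0.
have le_pow (u : R) : 0 <= u -> u <= x + y -> u <= (x + y) `^ (1 - p) * u `^ p.
  move=> u0 uxy; have [->|un] := eqVneq u 0; first by rewrite mulr_ge0 ?powR_ge0.
  have {1}-> : u = u `^ (1 - p) * u `^ p by rewrite -powRD ?subrK ?powRr1 // un implybT.
  rewrite ler_wpM2r ?powR_ge0 //.
  by apply: ge0_ler_powR; rewrite ?nnegrE ?subr_ge0 // ltW.
have c0 : 0 < (x + y) `^ (1 - p) by rewrite powR_gt0.
rewrite -(ler_pM2l c0) -powRD ?subrK ?powRr1 ?(ltW xyp) ?xyn ?implybT //.
by rewrite mulrDr lerD // le_pow // ?lerDl ?lerDr.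
Qed.

Lemma powR_sum_le (R : realType) (I : Type) (l : seq I) (P : pred I)
    (F : I -> R) (p : R) :
  0 < p -> p <= 1 -> (forall i, 0 <= F i) ->
  (\sum_(i <- l | P i) F i) `^ p <= \sum_(i <- l | P i) F i `^ p.
Proof.
move=> p0 p1 F0.
suff [] : 0 <= \sum_(i <- l | P i) F i /\
  (\sum_(i <- l | P i) F i) `^ p <= \sum_(i <- l | P i) F i `^ p by [].
elim/big_rec2: _ => [|i x y _ [y0 h]]; first by rewrite powR0 ?gt_eqF.
split; first exact: addr_ge0.
by apply: (le_trans (powRD_le p0 p1 (F0 i) y0)); rewrite lerD2l.
Qed.

Section bad_generators.
Variables (R : realType) (d : nat) (alpha : R) (gamma : nat -> R).
Hypothesis alpha_gt0 : 0 < alpha.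
Hypothesis gamma01 : forall j, 0 <= gamma j <= 1.
Implicit Types (k : d.-tuple int).
Local Notation q := (inv_weight alpha gamma).
Variable s : R.
Hypothesis s_gt0 : 0 < s.
Hypothesis as_gt1 : 1 < alpha * s.

Definition freq_div N k : d.-tuple int := [tuple (tnth k j %/ N%:Z)%Z | j < d].

(** Every nonzero coordinate contributes a factor N^(-alpha s) <= 1/N. *)
Lemma inv_weight_multiple N k : (0 < N)%N -> nonzero k ->
  [forall j, (N%:Z %| tnth k j)%Z] ->
  q k `^ s <= N%:R^-1 * q (freq_div N k) `^ s.
Proof.
move=> N0 /existsP[j0 k0] /forallP Nk; rewrite !inv_weight_powR //.
have N1 : 1 <= N%:R :> R by rewrite ler1n.
have Np : 0 < N%:R :> R by rewrite ltr0n.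
have NV : N%:R `^ (- (alpha * s)) <= N%:R^-1 :> R.
  rewrite powRN lef_pV2 ?posrE ?powR_gt0 //.
  by rewrite -[leLHS](powRr1 (a := N%:R)) ?ler0n //; apply: ler_powR => //; exact: ltW.
have NV1 : N%:R^-1 <= 1 :> R by rewrite invf_le1.
have E j : tnth k j != 0 -> coord_weight alpha gamma s j (tnth k j) =
    N%:R `^ (- (alpha * s)) * coord_weight alpha gamma s j (tnth (freq_div N k) j).
  move=> kj; rewrite /coord_weight tnth_mktuple (negbTE kj).
  have kE : tnth k j = (tnth k j %/ N)%Z * N%:Z by rewrite divzK.
  have kn0 : (tnth k j %/ N)%Z != 0 by apply: contra kj => /eqP h; rewrite kE h mul0r.
  rewrite (negbTE kn0) {1}kE normrM rmorphM powRM ?ler0z ?normr_ge0 //.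
  rewrite [RHS]mulrC -mulrA; congr (_ * (_ * _)).
rewrite (bigD1 j0) //= [in leRHS](bigD1 j0) //= mulrA; apply: ler_pM.
- exact: pow_weight1_ge0.
- by apply: prodr_ge0 => j _; exact: pow_weight1_ge0.
- by rewrite E // ler_wpM2r ?pow_weight1_ge0.
apply: ler_prod => j _; rewrite pow_weight1_ge0 /=.
have [kj|kj] := eqVneq (tnth k j) 0; last first.
  by rewrite E // ler_piMl ?pow_weight1_ge0 // (le_trans NV).
by rewrite tnth_mktuple kj div0z.
Qed.

(** Frequencies divisible by N are dual for every generator; dividing by N
shows that they carry only a small part of the sum. *)
Lemma sum_multiples_le N (l : seq (d.-tuple int)) : (0 < N)%N -> uniq l ->
  \sum_(k <- l | nonzero k && [forall j, (N%:Z %| tnth k j)%Z]) q k `^ s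
    <= zeta_prod d alpha gamma s / N%:R.
Proof.
move=> N0 ul; rewrite -big_filter; set t := [seq k <- l | _].
have tP k : k \in t -> nonzero k /\ [forall j, (N%:Z %| tnth k j)%Z].
  by rewrite mem_filter => /andP[/andP[]].
have ut : uniq [seq freq_div N k | k <- t].
  rewrite map_inj_in_uniq ?filter_uniq // => k k'.
  move=> /tP[_ /forallP kN] /tP[_ /forallP kN'] h; apply: eq_from_tnth => j.
  have := congr1 (fun v => tnth v j) h; rewrite /= !tnth_mktuple.
  by rewrite -{2}(divzK (kN j)) -{2}(divzK (kN' j)) => ->.
apply: (@le_trans _ _ (\sum_(k <- t) N%:R^-1 * q (freq_div N k) `^ s)).
  rewrite big_seq [leRHS]big_seq; apply: ler_sum => k /tP[k0 kN].
  exact: inv_weight_multiple.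
rewrite -mulr_sumr mulrC ler_wpM2r ?invr_ge0 ?ler0n //.
rewrite -(big_map (freq_div N) xpredT (fun k => q k `^ s)).
exact: sum_inv_weight_le.
Qed.

Hypothesis s_le2 : s <= 2.

(** Markov's inequality for the sum of q^s over the nonzero dual frequencies.
Its mean over generators is at most 2P/N from frequencies not divisible by N
plus P/N from multiples, and it is at least B^s when the worst-case error
exceeds B, because s <= 2. *)
Lemma card_bad_generators_le N (B : R) : prime N -> 0 < B ->
  #|finset (fun z => (z \in generators d N) &&
      (B%:E < wce alpha gamma (lattice_points R z))%E)|%:R * B `^ s
    <= 3 * zeta_prod d alpha gamma s / N%:R * #|generators d N|%:R.
Proof.
move=> Np B0; have N0 := prime_gt0 Np; have N1 := prime_gt1 Np.
set gen := generators d N; set bad := finset _.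
set P := zeta_prod _ _ _ _.
have [||l ul hl] := @common_finite_list _ _
  (fun (z : d.-tuple 'I_N) (l : seq (d.-tuple int)) =>
   z \in bad -> B ^+ 2 < \sum_(k <- l | nonzero k && in_dual z k) q k ^+ 2).
- move=> z l l' ul ul' ll' h zb; apply: lt_le_trans (h zb) _.
  by apply: ler_sum_subseq => // k; exact: sqr_ge0.
- move=> z; have [zb|zb] := boolP (z \in bad); last by exists [::].
  have Bz : (B%:E < wce alpha gamma (lattice_points R z))%E.
    by move: zb; rewrite inE => /andP[].
  have [l ul hl] := lt_wce_dual_sum alpha_gt0 gamma01 N0 B0 Bz.
  by exists l.
have badB z : z \in bad -> B `^ s <= \sum_(k <- l | nonzero k && in_dual z k) q k `^ s.
  move=> /hl Bl; have BE : B `^ s = (B ^+ 2) `^ (s / 2).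
    by rewrite -powR_mulrn ?ltW // -powRrM mulrCA divff ?mulr1 // pnatr_eq0.
  rewrite BE; apply: (@le_trans _ _
    ((\sum_(k <- l | nonzero k && in_dual z k) q k ^+ 2) `^ (s / 2))).
    apply: ge0_ler_powR; rewrite ?nnegrE ?sqr_ge0 //.
    - by rewrite divr_ge0 // ltW.
    - by apply: sumr_ge0 => k _; exact: sqr_ge0.
    - exact: ltW.
  apply: le_trans.
    apply: powR_sum_le => [||k]; last exact: sqr_ge0.
      by rewrite divr_gt0.
    by rewrite ler_pdivrMr // mul1r.
  apply: ler_sum => k _; rewrite -powR_mulrn ?inv_weight_ge0 // -powRrM.
  by rewrite mulrCA divff ?mulr1 // pnatr_eq0.
have bg : bad \subset gen by apply/fintype.subsetP => z; rewrite inE => /andP[].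
apply: (@le_trans _ _
  (\sum_(z in gen) \sum_(k <- l | nonzero k && in_dual z k) q k `^ s)).
  rewrite mulr_natl -sumr_const; apply: (@le_trans _ _
    (\sum_(z in bad) \sum_(k <- l | nonzero k && in_dual z k) q k `^ s)).
    by apply: ler_sum => z /badB.
  rewrite [leRHS](big_setID bad) /= (finset.setIidPr bg) lerDl.
  by do 2 (apply: sumr_ge0 => ? _); exact: powR_ge0.
have -> : \sum_(z in gen) \sum_(k <- l | nonzero k && in_dual z k) q k `^ s =
   \sum_(k <- l | nonzero k)
     q k `^ s * #|finset (fun z => (z \in gen) && in_dual z k)|%:R.
  under eq_bigr do rewrite big_mkcondr /=.
  rewrite exchange_big /=; apply: eq_bigr => k _.
  rewrite -big_mkcondr /= sumr_const mulr_natr; congr (_ *+ _).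
  by apply: eq_card => z; rewrite inE.
rewrite (bigID (fun k => [forall j, (N%:Z %| tnth k j)%Z])) /=.
have G0 : 0 <= #|gen|%:R :> R by rewrite ler0n.
have h1 : \sum_(k <- l | nonzero k && [forall j, (N%:Z %| tnth k j)%Z])
    q k `^ s * #|finset (fun z => (z \in gen) && in_dual z k)|%:R <= P / N%:R * #|gen|%:R.
  apply: (@le_trans _ _ (\sum_(k <- l | nonzero k && [forall j, (N%:Z %| tnth k j)%Z])
    q k `^ s * #|gen|%:R)).
    apply: ler_sum => k _; rewrite ler_wpM2l ?powR_ge0 // ler_nat subset_leq_card //.
    by apply/fintype.subsetP => z; rewrite inE => /andP[].
  rewrite -mulr_suml ler_wpM2r //; exact: sum_multiples_le.
have N1r : (0 < N.-1)%N by rewrite -subn1 subn_gt0.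
have h2 : \sum_(k <- l | nonzero k && ~~ [forall j, (N%:Z %| tnth k j)%Z])
    q k `^ s * #|finset (fun z => (z \in gen) && in_dual z k)|%:R
      <= P * (2 / N%:R * #|gen|%:R).
  apply: (@le_trans _ _
    (\sum_(k <- l | nonzero k && ~~ [forall j, (N%:Z %| tnth k j)%Z])
    q k `^ s * (2 / N%:R * #|gen|%:R))).
    apply: ler_sum => k /andP[_ kN]; rewrite ler_wpM2l ?powR_ge0 //.
    have := card_dual_le Np kN; rewrite -(ler_nat R) natrM -/gen => h.
    rewrite mulrAC ler_pdivlMr ?ltr0n //.
    set c : R := #|_|%:R in h *.
    have c0 : 0 <= c by rewrite ler0n.
    have NN : N%:R = N.-1%:R + 1 :> R by rewrite natr1 prednK.
    have : 1 <= N.-1%:R :> R by rewrite ler1n.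
    by rewrite NN; nra.
  rewrite -mulr_suml ler_wpM2r //.
  have := sum_inv_weight_le gamma01 as_gt1 ul; rewrite -/P; apply: le_trans.
  rewrite [leRHS](bigID
    (fun k => nonzero k && ~~ [forall j, (N%:Z %| tnth k j)%Z])) /= lerDl.
  by apply: sumr_ge0 => k _; exact: powR_ge0.
lra.
Qed.

End bad_generators.

(** * Averages of dual membership *)

Section uniform_means.
Variables (R : realType) (T : finType) (A : {set T}).
Implicit Types F G : T -> R.

Lemma le_uniform_mean F G : (forall x, x \in A -> F x <= G x) ->
  uniform_mean A F <= uniform_mean A G.
Proof. by move=> FG; rewrite ler_wpM2l ?invr_ge0 ?ler0n // ler_sum. Qed.

Lemma uniform_meanD F G :
  uniform_mean A (fun x => F x + G x) = uniform_mean A F + uniform_mean A G.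
Proof. by rewrite /uniform_mean big_split mulrDr. Qed.

Lemma uniform_meanZl (c : R) F :
  uniform_mean A (fun x => c * F x) = c * uniform_mean A F.
Proof. by rewrite /uniform_mean -mulr_sumr mulrCA. Qed.

Lemma uniform_mean_cst_le (c : R) : 0 <= c -> uniform_mean A (fun=> c) <= c.
Proof.
move=> c0; rewrite /uniform_mean sumr_const -[c *+ _]mulr_natl mulrA.
have [->|A0] := posnP #|A|; first by rewrite mulr0 mul0r.
by rewrite mulVf ?mul1r // pnatr_eq0 -lt0n.
Qed.

Lemma uniform_mean_indic (P : pred T) :
  uniform_mean A (fun x => (P x)%:R : R) =
  #|finset (fun x => (x \in A) && P x)|%:R / #|A|%:R.
Proof.
rewrite /uniform_mean mulrC; congr (_ * _).
rewrite (eq_bigr (fun x => if P x then 1 else 0)); last by move=> x _; case: (P x).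
rewrite -big_mkcondr sumr_const; congr (_%:R); apply: eq_card => x.
by rewrite inE.
Qed.

Lemma uniform_mean_sum (I : Type) (l : seq I) (Q : pred I) (F : I -> T -> R) :
  uniform_mean A (fun x => \sum_(i <- l | Q i) F i x) =
  \sum_(i <- l | Q i) uniform_mean A (F i).
Proof. by rewrite /uniform_mean exchange_big mulr_sumr. Qed.

End uniform_means.

Section lattice_bounds.
Variables (R : realType) (d : nat) (alpha : R) (gamma : nat -> R).
Hypothesis alpha_gt : 2^-1 < alpha.
Hypothesis gamma01 : forall j, 0 <= gamma j <= 1.
Implicit Types (k : d.-tuple int) (f : d.-tuple R -> R).
Local Notation q := (inv_weight alpha gamma).
Let alpha_gt0 : 0 < alpha. Proof. by apply: lt_trans alpha_gt; rewrite invr_gt0. Qed.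

(** Cauchy-Schwarz over all nonzero frequencies. *)
Lemma integration_error_le_all f N (z : d.-tuple 'I_N) : (0 < N)%N ->
  korobov_ball alpha gamma f ->
  integration_error (lattice_points R z) f <= zeta_prod d alpha gamma 2 `^ 2^-1.
Proof.
move=> N0 fB; apply/ler_addgt0Pr => e e0.
have [_ af _ _] := fB.1.
have [l ul hl] := integration_error_le_dual z af N0 e0.
apply: (le_trans (hl l ul (fun _ => id))); rewrite lerD2r.
have as1 : 1 < alpha * 2 by have := alpha_gt; lra.
have P1 := @zeta_prod_ge1 R d alpha gamma 2 as1.
have P0 : 0 < zeta_prod d alpha gamma 2 by apply: lt_le_trans P1.
rewrite -[leLHS](_ : \sum_(k <- l | nonzero k && in_dual z k)
    cabs (fourier_coef f k) * 1 = _); last first.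
  by apply: eq_bigr => k _; rewrite mulr1.
apply: (korobov_ball_sum_le alpha_gt0 gamma01 fB ul); first by rewrite powR_gt0.
rewrite powR12_sqrt ?(ltW P0) // sqr_sqrtr ?(ltW P0) //.
apply: le_trans (sum_inv_weight_le gamma01 as1 ul).
rewrite [leRHS](bigID (fun k => nonzero k && in_dual z k)) /= -[leLHS]addr0.
apply: lerD; last by apply: sumr_ge0 => k _; exact: powR_ge0.
by apply: ler_sum => k _; rewrite mul1r powR_mulrn ?inv_weight_ge0.
Qed.

Lemma inv_weight_le_coord k j : tnth k j != 0 ->
  q k <= (`|tnth k j|%:~R `^ alpha)^-1.
Proof.
move=> kj; have f01 (i : 'I_d) : tnth k i != 0 ->
    0 <= gamma i / `|tnth k i|%:~R `^ alpha <= (`|tnth k i|%:~R `^ alpha)^-1.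
  move=> ki; have /andP[g0 g1] := gamma01 i.
  have p1 := powR_intr_norm_ge1 alpha_gt0 ki.
  by rewrite divr_ge0 ?powR_ge0 //= ler_piMl // invr_ge0 powR_ge0.
rewrite /inv_weight (bigD1 j) //=; have /andP[h0 h1] := f01 j kj.
suff /andP[r0 r1] : 0 <= \prod_(i < d | (tnth k i != 0) && (i != j))
    (gamma i / `|tnth k i|%:~R `^ alpha) <= 1.
  by rewrite -[leRHS]mulr1; apply: ler_pM.
elim/big_ind: _ => [|x y /andP[x0 x1] /andP[y0 y1]|i /andP[ki _]].
- by rewrite ler01 lexx.
- by rewrite mulr_ge0 //= mulr_ile1.
have /andP[h2 h] := f01 i ki; rewrite h2 /=; apply: (le_trans h).
by rewrite invf_le1 ?(lt_le_trans ltr01) // powR_intr_norm_ge1.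
Qed.

(** q(k) is at most |k_j|^(-alpha) for each nonzero coordinate. *)
Lemma coord_powR_le (e t : R) k j : 0 <= t -> e <= alpha * t -> tnth k j != 0 ->
  q k != 0 -> `|tnth k j|%:~R `^ e <= q k `^ (- t).
Proof.
move=> t0 et kj q0.
have qp : 0 < q k by rewrite lt0r q0 inv_weight_ge0.
have n1 := @intr_norm_ge1 R _ kj.
have p1 := powR_intr_norm_ge1 alpha_gt0 kj.
have p0 : 0 < `|tnth k j|%:~R `^ alpha :> R by apply: lt_le_trans p1.
apply: (@le_trans _ _ (`|tnth k j|%:~R `^ (alpha * t))); first exact: ler_powR.
rewrite powRrM powRN -[leRHS]mul1r ler_pdivlMr ?powR_gt0 //.
rewrite -powRM ?(ltW p0) ?(ltW qp) //.
have h : `|tnth k j|%:~R `^ alpha * q k <= 1.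
  by rewrite mulrC -ler_pdivlMr // mul1r inv_weight_le_coord.
have : (`|tnth k j|%:~R `^ alpha * q k) `^ t <= 1 `^ t.
  by apply: ge0_ler_powR; rewrite ?nnegrE // mulr_ge0 // ltW.
by rewrite powR1.
Qed.

End lattice_bounds.

Lemma leq_4pred_uphalf M N : (1 < N)%N -> (uphalf M < N)%N -> (M <= 4 * N.-1)%N.
Proof. lia. Qed.

(** For a prime not dividing k_j a random generator is dual with probability
at most 1/(N-1) <= 4/M. *)
Lemma mean_dual_le (R : realType) d M (k : d.-tuple int) j :
  (2 <= M)%N -> tnth k j != 0 ->
  uniform_mean (prime_range M) (fun N : 'I_M.+1 =>
    uniform_mean (generators d N) (fun z => (in_dual z k)%:R : R)) <=
  #|finset (fun p : 'I_M.+1 => (p \in prime_range M) && (p %| `|tnth k j|)%N)|%:R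
    / #|prime_range M|%:R + 4 / M%:R.
Proof.
move=> M2 kj; rewrite -uniform_mean_indic.
have M0 : 0 < M%:R :> R by rewrite ltr0n; lia.
have c0 : 0 <= 4 / M%:R :> R by rewrite divr_ge0 // ltW.
apply: (@le_trans _ _ (uniform_mean (prime_range M) (fun N : 'I_M.+1 =>
   (N %| `|tnth k j|)%N%:R + 4 / M%:R))); last first.
  by rewrite uniform_meanD lerD2l uniform_mean_cst_le.
apply: le_uniform_mean => N; rewrite inE => /andP[Np MN].
have G0 := card_generators_gt0 d Np.
have G0r : 0 < #|generators d N|%:R :> R by rewrite ltr0n.
rewrite uniform_mean_indic ler_pdivrMr //.
have [Nk|Nk] := boolP (N %| `|tnth k j|)%N.
  apply: (@le_trans _ _ #|generators d N|%:R).
    rewrite ler_nat subset_leq_card //.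
    by apply/fintype.subsetP => z; rewrite inE => /andP[].
  by rewrite ler_peMl ?ler0n // lerDl.
have Nk' : ~~ [forall j, ((N : nat)%:Z %| tnth k j)%Z].
  by apply/forallPn; exists j; rewrite dvdzE.
have := card_dual_le Np Nk'; rewrite -(ler_nat R) natrM => h.
rewrite add0r mulrAC ler_pdivlMr //.
set c : R := #|_|%:R in h *.
have c00 : 0 <= c by rewrite ler0n.
have hN : M%:R <= 4 * (N : nat).-1%:R :> R.
  by rewrite -natrM ler_nat leq_4pred_uphalf // prime_gt1.
by nra.
Qed.

(** * The selected generator *)

Section assembly.
Variables (R : realType) (d : nat) (alpha : R) (gamma : nat -> R).
Variables (r M : nat) (eta lambda : R) (sel : selection d r).
Hypothesis alpha_gt : 2^-1 < alpha.
Hypothesis gamma01 : forall j, 0 <= gamma j <= 1.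
Hypothesis M_ge2 : (2 <= M)%N.
Hypothesis eta01 : 0 < eta < 1.
Hypothesis sel_min : minimizing M alpha gamma sel.
Hypothesis lambda_gt : 2^-1 < lambda.
Hypothesis lambda_lt : lambda < alpha.
Local Notation q := (inv_weight alpha gamma).
Local Notation err z f := (integration_error (lattice_points R z) f).
Local Notation P := (zeta_prod d alpha gamma lambda^-1).

Let alpha_gt0 : 0 < alpha. Proof. by apply: lt_trans alpha_gt; rewrite invr_gt0. Qed.
Let lambda_gt0 : 0 < lambda. Proof. by apply: lt_trans lambda_gt; rewrite invr_gt0. Qed.
Let s_gt0 : 0 < lambda^-1. Proof. by rewrite invr_gt0. Qed.
Let as_gt1 : 1 < alpha * lambda^-1. Proof. by rewrite ltr_pdivlMr // mul1r. Qed.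
Let s_le2 : lambda^-1 <= 2.
Proof. by rewrite -[2]invrK lef_pV2 ?posrE // ltW. Qed.
Let P_ge1 : 1 <= P. Proof. exact: zeta_prod_ge1. Qed.
Let P_gt0 : 0 < P. Proof. exact: lt_le_trans P_ge1. Qed.
Let eta_gt0 : 0 < 1 - eta. Proof. by rewrite subr_gt0; case/andP: eta01. Qed.

(** The bound on the worst-case error that a generator satisfies with
probability at least eta when x = N, by Markov's inequality. *)
Definition threshold (x : R) : R := (3 * P / ((1 - eta) * x)) `^ lambda.

Definition good_generator N (z : d.-tuple 'I_N) : bool :=
  (wce alpha gamma (lattice_points R z) <= (threshold N%:R)%:E)%E.

Lemma threshold_powR x : 0 < x -> threshold x `^ lambda^-1 = 3 * P / ((1 - eta) * x).
Proof.
move=> x0; rewrite /threshold -powRrM divff ?gt_eqF // powRr1 //.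
by rewrite ltW // divr_gt0 ?mulr_gt0.
Qed.

Lemma threshold_gt0 x : 0 < x -> 0 < threshold x.
Proof. by move=> x0; rewrite powR_gt0 // divr_gt0 ?mulr_gt0. Qed.

Lemma threshold_le x y : 0 < x -> x <= y -> threshold y <= threshold x.
Proof.
move=> x0 xy; have y0 : 0 < y by exact: lt_le_trans xy.
apply: ge0_ler_powR; rewrite ?nnegrE; first exact: ltW.
- by rewrite ltW // divr_gt0 ?mulr_gt0.
- by rewrite ltW // divr_gt0 ?mulr_gt0.
by rewrite ler_pM2l ?mulr_gt0 // lef_pV2 ?posrE ?mulr_gt0 // ler_pM2l.
Qed.

Lemma bad_fraction_le N : prime N ->
  #|finset (fun z => (z \in generators d N) && ~~ good_generator z)|%:R
    <= (1 - eta) * #|generators d N|%:R :> R.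
Proof.
move=> Np; have N0 : 0 < N%:R :> R by rewrite ltr0n prime_gt0.
have := card_bad_generators_le d alpha_gt0 gamma01 s_gt0 as_gt1 s_le2 Np
  (threshold_gt0 N0).
rewrite threshold_powR // => h.
have y0 : 0 < 3 * P / ((1 - eta) * N%:R) by rewrite divr_gt0 ?mulr_gt0.
rewrite -(ler_pM2r y0).
have -> : (1 - eta) * #|generators d N|%:R * (3 * P / ((1 - eta) * N%:R)) =
    3 * P / N%:R * #|generators d N|%:R.
  by field; rewrite !gt_eqF.
apply: le_trans h; rewrite ler_pM2r // ler_nat subset_leq_card //.
by apply/fintype.subsetP => z; rewrite !inE /good_generator -ltNge.
Qed.

(** If some draw is good, the selected one is good as well, by minimality, and
its error is one of the terms of the sum over good draws; all draws are bad with
probability at most (1-eta)^r. *)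
Lemma selected_error_le (N : 'I_M.+1) f :
  N \in prime_range M -> korobov_ball alpha gamma f ->
  uniform_mean (draws d r N) (fun zs => err (tnth zs (@sel N zs)) f) <=
  r%:R * uniform_mean (generators d N) (fun z => (good_generator z)%:R * err z f)
  + (1 - eta) ^+ r * zeta_prod d alpha gamma 2 `^ 2^-1.
Proof.
move=> NM fB; have Np : prime N by move: NM; rewrite inE => /andP[].
have N0 := prime_gt0 Np.
have G0 := card_generators_gt0 d Np.
have G0r : 0 < #|generators d N|%:R :> R by rewrite ltr0n.
set E2 := zeta_prod _ _ _ _ `^ _.
have E20 : 0 <= E2 by exact: powR_ge0.
pose bad : {set d.-tuple 'I_N} :=
  finset (fun z => (z \in generators d N) && ~~ good_generator z).
apply: (@le_trans _ _ (uniform_mean (draws d r N) (fun zs =>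
   \sum_(i < r) (good_generator (tnth zs i))%:R * err (tnth zs i) f
   + E2 * [forall i, tnth zs i \in bad]%:R))).
  apply: le_uniform_mean => zs zsD.
  have t0 (i : 'I_r) : 0 <= (good_generator (tnth zs i))%:R * err (tnth zs i) f.
    by rewrite mulr_ge0 ?ler0n // normr_ge0.
  case: (boolP [forall i, tnth zs i \in bad]) => [ab|nb].
    apply: (le_trans (integration_error_le_all alpha_gt gamma01 _ N0 fB)).
    by rewrite mulr1 lerDr; apply: sumr_ge0 => i _; exact: t0.
  have [i ib] : exists i, tnth zs i \notin bad by apply/existsP; rewrite -negb_forall.
  have zg : tnth zs i \in generators d N.
    by move: zsD; rewrite inE => /forallP.
  have gi : good_generator (tnth zs i) by move: ib; rewrite inE zg /= negbK.
  have gs : good_generator (tnth zs (@sel N zs)) by exact: le_trans (sel_min NM zsD i) gi.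
  rewrite mulr0 addr0 (bigD1 (@sel N zs)) //= gs mul1r lerDl.
  by apply: sumr_ge0 => i0 _; exact: t0.
rewrite uniform_meanD; apply: lerD.
  rewrite uniform_mean_sum.
  under eq_bigr => i _ do
    rewrite (uniform_mean_coordinate i (fun z => (good_generator z)%:R * err z f) G0).
  by rewrite sumr_const card_ord mulr_natl.
rewrite uniform_meanZl mulrC ler_wpM2r // uniform_mean_indic.
have bg : bad \subset generators d N.
  by apply/fintype.subsetP => z; rewrite inE => /andP[].
have := card_draws_all R r bg; rewrite card_draws_expn => ->.
rewrite -expr_div_n; apply: lerXn2r; rewrite ?nnegrE ?divr_ge0 ?ler0n ?(ltW eta_gt0) //.
by rewrite ler_pdivrMr // bad_fraction_le.
Qed.

End assembly.

(** * The mean error over good generators *)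

Lemma leq_double_uphalf M N : (uphalf M < N)%N -> (M <= N * 2)%N.
Proof. lia. Qed.

Section good_mean.
Variables (R : realType) (d : nat) (alpha : R) (gamma : nat -> R).
Variables (M : nat) (eta lambda delta c : R).
Hypothesis alpha_gt : 2^-1 < alpha.
Hypothesis gamma01 : forall j, 0 <= gamma j <= 1.
Hypothesis M_ge2 : (2 <= M)%N.
Hypothesis eta01 : 0 < eta < 1.
Hypothesis lambda_gt : 2^-1 < lambda.
Hypothesis lambda_lt : lambda < alpha.
Hypothesis delta_gt0 : 0 < delta.
Hypothesis delta_lt : delta < lambda - 2^-1.
(* so that |k_j|^(2e) <= |k_j|^(alpha delta/lambda), as alpha > 1/2 *)
Let e := delta / lambda / 4.
Hypothesis c_gt0 : 0 < c.
Hypothesis c_primes : forall m, (0 < m)%N ->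
  #|finset (fun p : 'I_M.+1 => (p \in prime_range M) && (p %| m)%N)|%:R
    / #|prime_range M|%:R <= c * m%:R `^ (e + e) / M%:R.
Local Notation q := (inv_weight alpha gamma).
Local Notation err z f := (integration_error (lattice_points R z) f).
Local Notation P := (zeta_prod d alpha gamma lambda^-1).
Local Notation thr := (threshold d alpha gamma eta lambda).
Local Notation good z := (good_generator alpha gamma eta lambda z).

Let alpha_gt0 : 0 < alpha. Proof. by apply: lt_trans alpha_gt; rewrite invr_gt0. Qed.
Let lambda_gt0 : 0 < lambda. Proof. by apply: lt_trans lambda_gt; rewrite invr_gt0. Qed.
Let s_gt0 : 0 < lambda^-1. Proof. by rewrite invr_gt0. Qed.
Let as_gt1 : 1 < alpha * lambda^-1. Proof. by rewrite ltr_pdivlMr // mul1r. Qed.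
Let P_gt0 : 0 < P. Proof. by apply: lt_le_trans (zeta_prod_ge1 d gamma as_gt1). Qed.
Let eta_gt0 : 0 < 1 - eta. Proof. by rewrite subr_gt0; case/andP: eta01. Qed.
Let M_gt0 : 0 < M%:R :> R. Proof. by rewrite ltr0n ltnW. Qed.

Let t := delta / lambda.
Let tau := lambda - delta - 2^-1.
Let tau_gt0 : 0 < tau. Proof. by rewrite /tau; have := delta_lt; lra. Qed.
Let t_gt0 : 0 < t. Proof. by rewrite divr_gt0. Qed.

(** An upper bound for the probability that the generator is good and k is
dual for it.  As N >= M/2, no good generator has a dual vector with q(k) above the
threshold at M/2. *)
Definition dual_prob_bound (k : d.-tuple int) : R :=
  if q k <= thr (M%:R / 2) then (c + 4) / M%:R * q k `^ (- t) else 0.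

Lemma dual_weight_ge0 k : 0 <= dual_prob_bound k.
Proof.
rewrite /dual_prob_bound; case: ifP => // _.
by rewrite mulr_ge0 ?powR_ge0 // divr_ge0 ?addr_ge0 // ltW.
Qed.

Lemma mean_good_dual_le (k : d.-tuple int) : nonzero k -> q k != 0 ->
  uniform_mean (prime_range M) (fun N : 'I_M.+1 =>
    uniform_mean (generators d N) (fun z => (good z && in_dual z k)%:R : R))
  <= dual_prob_bound k.
Proof.
move=> k0 q0; rewrite /dual_prob_bound; case: ifPn => qk.
  have /existsP[j kj] := k0.
  apply: (@le_trans _ _ (uniform_mean (prime_range M) (fun N : 'I_M.+1 =>
    uniform_mean (generators d N) (fun z => (in_dual z k)%:R : R)))).
    apply: le_uniform_mean => N _; apply: le_uniform_mean => z _.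
    by rewrite ler_nat; case: (good z); case: (in_dual z k).
  apply: (le_trans (mean_dual_le R M_ge2 kj)).
  have m0 : (0 < `|tnth k j|)%N by rewrite absz_gt0.
  have := c_primes m0; rewrite natr_absz; set y := _ `^ (e + e) => h.
  have eE : e + e <= alpha * t.
    have : t / 2 <= alpha * t by rewrite mulrC ler_pM2r // ltW.
    by rewrite /e -/t; lra.
  have y1 : y <= q k `^ (- t) by exact: coord_powR_le (ltW t_gt0) eE kj q0.
  have y2 : 1 <= y.
    have e0 : 0 <= e + e by rewrite addr_ge0 // ltW // divr_gt0.
    have : `|tnth k j|%:~R `^ 0 <= y by apply: ler_powR => //; exact: intr_norm_ge1.
    by rewrite powRr0.
  apply: (le_trans (lerD h (lexx _))).
  rewrite -mulrDl mulrAC; rewrite ler_pM2r ?invr_gt0 //.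
  rewrite mulrDl; apply: lerD; first by rewrite ler_pM2l.
  by rewrite ler_peMr // (le_trans y2).
rewrite -ltNge in qk.
apply: (@le_trans _ _ (uniform_mean (prime_range M) (fun N : 'I_M.+1 => 0))).
  apply: le_uniform_mean => N; rewrite inE => /andP[Np MN].
  apply: (@le_trans _ _ (uniform_mean (generators d N) (fun=> 0))).
    apply: le_uniform_mean => z _.
    case: (boolP (good z && in_dual z k)) => // /andP[gz dz]; exfalso.
    have := inv_weight_le_wce alpha_gt0 gamma01 k0 q0 (prime_gt0 Np) dz.
    move=> /le_trans /(_ gz); rewrite lee_fin => qN.
    have MN2 : M%:R / 2 <= N%:R :> R.
      by rewrite ler_pdivrMr // -natrM ler_nat leq_double_uphalf.
    have M20 : 0 < M%:R / 2 :> R by rewrite divr_gt0.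
    have := threshold_le d gamma eta01 lambda_gt lambda_lt M20 MN2.
    by move=> /(le_trans qN); rewrite leNgt qk.
  exact: uniform_mean_cst_le.
exact: uniform_mean_cst_le.
Qed.

(** The square root of the bound [sum_dual_prob_bound_le] for the weights of
the final Cauchy-Schwarz inequality. *)
Definition good_mean_bound : R :=
  (c + 4) / M%:R * thr (M%:R / 2) `^ (tau / lambda) * P `^ 2^-1.

(** Below the threshold T, q^(2-2t) splits as q^(2 tau/lambda) q^(1/lambda),
where t = delta/lambda and tau = lambda - delta - 1/2; the first factor is at most
T^(2 tau/lambda) and the second sums to P. *)
Lemma sum_dual_prob_bound_le (l : seq (d.-tuple int)) : uniq l ->
  \sum_(k <- l | nonzero k) (dual_prob_bound k * q k) ^+ 2 <= good_mean_bound ^+ 2.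
Proof.
move=> ul; have M20 : 0 < M%:R / 2 :> R by rewrite divr_gt0.
have thr0 := threshold_gt0 d gamma eta01 lambda_gt lambda_lt M20.
apply: (@le_trans _ _ (\sum_(k <- l | nonzero k)
   ((c + 4) / M%:R * thr (M%:R / 2) `^ (tau / lambda)) ^+ 2 * q k `^ lambda^-1)).
  apply: ler_sum => k _; rewrite /dual_prob_bound.
  have [q0|q0] := eqVneq (q k) 0.
    by rewrite q0 mulr0 expr0n /= mulr_ge0 ?sqr_ge0 // powR_ge0.
  have qp : 0 < q k by rewrite lt0r q0 inv_weight_ge0.
  case: ifP => qk; last by rewrite mul0r expr0n /= mulr_ge0 ?sqr_ge0 // powR_ge0.
  move: ((c + 4) / M%:R) => a.
  rewrite -mulrA !exprMn -[leRHS]mulrA ler_wpM2l ?sqr_ge0 //.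
  have -> : (q k `^ (- t)) ^+ 2 * q k ^+ 2 =
      q k `^ (2 * (tau / lambda)) * q k `^ lambda^-1.
    rewrite -!powR_mulrn ?powR_ge0 ?inv_weight_ge0 // -powRrM -!powRD ?q0 ?implybT //.
    congr (_ `^ _); rewrite /tau /t; field; by rewrite gt_eqF.
  rewrite ler_wpM2r ?powR_ge0 // -powR_mulrn ?powR_ge0 // -powRrM [_ * 2]mulrC.
  apply: ge0_ler_powR; rewrite ?nnegrE ?(ltW qp) ?(ltW thr0) //.
  by rewrite mulr_ge0 // divr_ge0 // ltW.
rewrite -mulr_sumr /good_mean_bound [leRHS]exprMn ler_wpM2l ?sqr_ge0 //.
rewrite powR12_sqrt ?(ltW P_gt0) // sqr_sqrtr ?(ltW P_gt0) //.
apply: le_trans (sum_inv_weight_le gamma01 as_gt1 ul).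
rewrite [leRHS](bigID (fun k => nonzero k)) /= lerDl.
by apply: sumr_ge0 => k _; exact: powR_ge0.
Qed.

Lemma good_mean_bound_gt0 : 0 < good_mean_bound.
Proof.
have M20 : 0 < M%:R / 2 :> R by rewrite divr_gt0.
have thr0 := threshold_gt0 d gamma eta01 lambda_gt lambda_lt M20.
rewrite /good_mean_bound; do 2 (apply: mulr_gt0; last by rewrite powR_gt0).
by rewrite divr_gt0 // addr_gt0.
Qed.

(** Expand the error over dual frequencies and exchange the sum over k with
the averages over N and z. *)
Lemma good_mean_le f : korobov_ball alpha gamma f ->
  uniform_mean (prime_range M) (fun N : 'I_M.+1 =>
    uniform_mean (generators d N) (fun z => (good z)%:R * err z f))
  <= good_mean_bound.
Proof.
move=> fB; apply/ler_addgt0Pr => e1 e10; have [_ af _ _] := fB.1.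
(* one finite list of frequencies must serve all N and z before the averages
   can be exchanged with the sum over k *)
pose I : finType := {N : 'I_M.+1 & d.-tuple 'I_N}.
have [||l ul hl] := @common_finite_list _ I (fun p (l : seq (d.-tuple int)) =>
  (0 < tag p)%N -> err (tagged p) f <=
    \sum_(k <- l | nonzero k && in_dual (tagged p) k) cabs (fourier_coef f k) + e1).
- move=> p l l' ul ul' ll' h p0; apply: (le_trans (h p0)); rewrite lerD2r.
  by apply: ler_sum_subseq => // k; exact: cabs_ge0.
- move=> p; have [p0|p0] := posnP (tag p).
    by exists [::] => //; rewrite p0.
  have [l ul hl] := integration_error_le_dual (tagged p) af p0 e10.
  by exists l => // _; exact: hl.
apply: (@le_trans _ _ (uniform_mean (prime_range M) (fun N : 'I_M.+1 =>
    uniform_mean (generators d N) (fun z =>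
      \sum_(k <- l | nonzero k)
        cabs (fourier_coef f k) * (good z && in_dual z k)%:R + e1)))).
  apply: le_uniform_mean => N; rewrite inE => /andP[Np _].
  apply: le_uniform_mean => z _.
  have [gz|gz] := boolP (good z); last first.
    rewrite mul0r addr_ge0 ?(ltW e10) // sumr_ge0 // => k _.
    by rewrite mulr_ge0 ?cabs_ge0.
  rewrite mul1r; apply: (le_trans (hl (existT _ N z) (prime_gt0 Np))).
  rewrite lerD2r big_mkcondr /=; apply: ler_sum => k _.
  by case: (in_dual z k); rewrite ?mulr1 ?mulr0.
have -> : (fun N : 'I_M.+1 => uniform_mean (generators d N) (fun z =>
      \sum_(k <- l | nonzero k)
        cabs (fourier_coef f k) * (good z && in_dual z k)%:R + e1)) =
   (fun N : 'I_M.+1 => \sum_(k <- l | nonzero k) cabs (fourier_coef f k) *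
      uniform_mean (generators d N) (fun z => (good z && in_dual z k)%:R : R)
      + uniform_mean (generators d N) (fun=> e1)).
  apply/funext => N; rewrite uniform_meanD; congr (_ + _).
  by rewrite uniform_mean_sum; apply: eq_bigr => k _; rewrite uniform_meanZl.
rewrite uniform_meanD; apply: lerD; last first.
  apply: (@le_trans _ _ (uniform_mean (prime_range M) (fun=> e1))).
    by apply: le_uniform_mean => N _; apply: uniform_mean_cst_le; exact: ltW.
  by apply: uniform_mean_cst_le; exact: ltW.
rewrite uniform_mean_sum.
apply: (@le_trans _ _
  (\sum_(k <- l | nonzero k) cabs (fourier_coef f k) * dual_prob_bound k)).
  apply: ler_sum => k k0; rewrite uniform_meanZl.
  have [q0|q0] := eqVneq (q k) 0.
    rewrite (korobov_fourier_coef0 alpha_gt0 gamma01 fB.1 q0).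
    by rewrite ComplexField.Normc.normc0 !mul0r.
  by rewrite ler_wpM2l ?cabs_ge0 // mean_good_dual_le.
apply: (korobov_ball_sum_le alpha_gt0 gamma01 fB ul good_mean_bound_gt0).
exact: sum_dual_prob_bound_le.
Qed.

Lemma good_mean_boundE : good_mean_bound =
  (c + 4) * 6 `^ tau / ((1 - eta) `^ tau * M%:R `^ (lambda - delta + 2^-1)) *
  P `^ (lambda - delta).
Proof.
have M20 : 0 < M%:R / 2 :> R by rewrite divr_gt0.
rewrite /good_mean_bound /threshold -powRrM [lambda * (tau / lambda)]mulrCA.
rewrite divff ?(gt_eqF lambda_gt0) // mulr1.
have -> : 3 * P / ((1 - eta) * (M%:R / 2)) = 6 * P * ((1 - eta) * M%:R)^-1.
  by field; rewrite !gt_eqF.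
have x0 : 0 <= ((1 - eta) * M%:R)^-1 by rewrite invr_ge0 mulr_ge0 // ltW.
rewrite powRM ?mulr_ge0 ?(ltW P_gt0) // powRM ?(ltW P_gt0) //.
have y0 : 0 < (1 - eta) * M%:R by rewrite mulr_gt0.
have -> : ((1 - eta) * M%:R)^-1 `^ tau = ((1 - eta) `^ tau * M%:R `^ tau)^-1.
  rewrite -powRM ?(ltW eta_gt0) ?(ltW M_gt0) //.
  by rewrite -powR_inv1 ?(ltW y0) // -powRrM mulN1r powRN.
have -> : lambda - delta + 2^-1 = tau + 1 by rewrite /tau; lra.
have -> : P `^ (lambda - delta) = P `^ tau * P `^ 2^-1.
  rewrite -powRD; last by rewrite (gt_eqF P_gt0) implybT.
  by congr (_ `^ _); rewrite /tau; lra.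
rewrite powRD; last by rewrite (gt_eqF M_gt0) implybT.
rewrite powRr1 ?(ltW M_gt0) //.
have a0 : (1 - eta) `^ tau != 0 by rewrite gt_eqF // powR_gt0.
have b0 : M%:R `^ tau != 0 by rewrite gt_eqF // powR_gt0.
have m0 : M%:R != 0 :> R by rewrite gt_eqF.
move: a0 b0; set a := _ `^ tau; set b := M%:R `^ tau; set p := P `^ tau.
set p2 := P `^ _; set six := 6 `^ tau => a0 b0.
by field; rewrite a0 b0 m0.
Qed.

End good_mean.

(** * The randomized error *)

Lemma powR_prod (R : realType) (I : finType) (F : I -> R) (p : R) :
  (forall i, 0 <= F i) -> (\prod_i F i) `^ p = \prod_i F i `^ p.
Proof.
move=> F0; suff [] : 0 <= \prod_i F i /\ (\prod_i F i) `^ p = \prod_i F i `^ p by [].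
elim/big_rec2: _ => [|i x y _ [y0 <-]]; first by rewrite powR1.
by rewrite mulr_ge0 // powRM.
Qed.

Lemma zeta_factor_ge0 (R : realType) (alpha s : R) (gamma : nat -> R) j :
  1 < alpha * s -> 0 <= 1 + 2 * gamma j `^ s * zeta (alpha * s).
Proof. by move=> as1; rewrite addr_ge0 // !mulr_ge0 ?powR_ge0 ?zeta_ge0. Qed.

Theorem theorem3p4 (R : realType) :
  exists C : R -> R -> R,
    (forall lambda delta : R, 2^-1 < lambda ->
       0 < delta -> delta < Num.min (lambda - 2^-1) 1 ->
       0 < C lambda delta) /\
    forall (d : nat) (alpha : R) (gamma : nat -> R) (r M : nat) (eta : R)
           (sel : selection d r),
      (0 < d)%N ->
      2^-1 < alpha ->
      (forall j, 0 <= gamma j <= 1) ->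
      (0 < r)%N ->
      (2 <= M)%N ->
      0 < eta < 1 ->
      minimizing M alpha gamma sel ->
      inf [set 2 * \prod_(j < d)
                 (1 + 2 * gamma j `^ lambda^-1 * zeta (alpha / lambda))
          | lambda in [set lambda | 2^-1 <= lambda < alpha]]
        <= (1 - eta) * M%:R ->
      forall lambda delta : R,
        2^-1 < lambda < alpha ->
        0 < delta ->
        delta < Num.min (lambda - 2^-1) 1 ->
        (randomized_error M alpha gamma sel <=
         ((r%:R * C lambda delta)
            / ((1 - eta) `^ (lambda - delta - 2^-1)
               * M%:R `^ (lambda - delta + 2^-1))
            * \prod_(j < d)
                (1 + 2 * gamma j `^ lambda^-1 * zeta (alpha / lambda))
                  `^ (lambda - delta)
          + (1 - eta) ^+ r
            * \prod_(j < d)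
                (1 + 2 * gamma j ^+ 2 * zeta (2 * alpha)) `^ 2^-1)%:E)%E.
Proof.
(* the constant of the prime count depends on lambda and delta only, through
   the exponent e = delta/(4 lambda) *)
have exc (x : R * R) : exists c : R, 0 < c /\
    (0 < x.2 -> x.2 < x.1 -> forall M m, (2 <= M)%N -> (0 < m)%N ->
     #|finset (fun p : 'I_M.+1 => (p \in prime_range M) && (p %| m)%N)|%:R
       / #|prime_range M|%:R
     <= c * m%:R `^ (x.2 / x.1 / 4 + x.2 / x.1 / 4) / M%:R).
  case: x => lambda delta /=.
  have [/andP[d0 dl]|nv] := boolP ((0 < delta) && (delta < lambda)); last first.
    by exists 1; split=> // d0 dl; move: nv; rewrite d0 dl.
  have l0 : 0 < lambda by exact: lt_trans dl.
  have t1 : delta / lambda < 1 by rewrite ltr_pdivrMr // mul1r.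
  have e0 : 0 < delta / lambda / 4 by rewrite !divr_gt0.
  have e2 : delta / lambda / 4 < 2^-1 by lra.
  by have [c c0 hc] := prime_divisor_fraction_le e0 e2; exists c.
have [c hc] := choice exc.
exists (fun lambda delta => (c (lambda, delta) + 4) * 6 `^ (lambda - delta - 2^-1)).
split=> [lambda delta _ _ _|].
  by rewrite mulr_gt0 ?powR_gt0 // addr_gt0 //; case: (hc (lambda, delta)).
move=> d alpha gamma r M eta sel d0 alpha_gt gamma01 r0 M2 eta01 sel_min _.
move=> lambda delta /andP[lambda_gt lambda_lt] delta0.
rewrite lt_min => /andP[delta_lt _].
have [c0 /= hcM] := hc (lambda, delta).
have lambda0 : 0 < lambda by apply: lt_trans lambda_gt; rewrite invr_gt0.
have dl : delta < lambda by apply: (lt_trans delta_lt); rewrite ltrBlDr ltrDl invr_gt0.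
have c_primes m := hcM delta0 dl M m M2.
have as1 : 1 < alpha * lambda^-1 by rewrite ltr_pdivlMr // mul1r.
have a21 : 1 < alpha * 2 by have := alpha_gt; lra.
apply: ub_ereal_sup => _ [f fB <-]; rewrite lee_fin.
set W := good_mean_bound d alpha gamma M eta lambda delta (c (lambda, delta)).
set E2 := zeta_prod d alpha gamma 2 `^ 2^-1.
have eta0 : 0 <= 1 - eta by rewrite subr_ge0 ltW //; case/andP: eta01.
have main : expected_error M sel f <= r%:R * W + (1 - eta) ^+ r * E2.
  apply: (@le_trans _ _ (uniform_mean (prime_range M) (fun N : 'I_M.+1 =>
    r%:R * uniform_mean (generators d N) (fun z =>
      (good_generator alpha gamma eta lambda z)%:R
        * integration_error (lattice_points R z) f)
    + (1 - eta) ^+ r * E2))).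
    by apply: le_uniform_mean => N NM; exact: selected_error_le.
  rewrite uniform_meanD; apply: lerD; last first.
    by apply: uniform_mean_cst_le; rewrite mulr_ge0 ?exprn_ge0 ?powR_ge0.
  rewrite uniform_meanZl ler_wpM2l ?ler0n //.
  exact: good_mean_le.
apply: (le_trans main); rewrite le_eqVlt; apply/orP; left; apply/eqP.
congr (_ + _ * _); last first.
  rewrite /E2 /zeta_prod powR_prod => [|j]; last exact: zeta_factor_ge0.
  apply: eq_bigr => j _; rewrite powR_mulrn ?[alpha * 2]mulrC //.
  by case/andP: (gamma01 j).
rewrite /W good_mean_boundE // /zeta_prod powR_prod => [|j]; last exact: zeta_factor_ge0.
by rewrite !mulrA.
Qed.
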